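(* Let $d$ be an odd prime, $n\ge1$, let $G$ be a positive convolution matrix over $\mathbb Z_d$ (invertible with all four entries nonzero), and let $\sigma$ be an $n$-qudit state, i.e. a state on $(\mathbb C^d)^{\otimes n}$. Then the quantum convolutional channel $\Lambda_\sigma$ satisfies $$n\log d-\min_{\mathcal M}S(\Delta_{\mathcal M}(\sigma))\ \le\ \chi(\Lambda_\sigma)\ \le\ n\log d-S(\sigma),$$ where the minimum is over all maximal isotropic subspaces $\mathcal M\subseteq V^n$. Moreover, $$\chi(\Lambda_\sigma)\ge n\log d-\mathfrak s_n(\sigma)\ge n\log d-S(M(\sigma)),$$ where $\mathfrak s_n(\sigma)=\min\{S(\Delta_{\mathcal M}(\sigma)):\mathcal M\text{ maximal isotropic},\ \mathcal M\supseteq S_\sigma\}$, $S_\sigma$ is the exact stabilizer skeleton of $\sigma$ and $M(\sigma)$ is its mean state.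
   Context: All logarithms are base two. $S(\rho)=-\operatorname{tr}\rho\log\rho$ is the von Neumann entropy. Weyl operators. $d$ is an odd prime, $\omega_d=e^{2\pi i/d}$. On one qudit $X|k\rangle=|k+1\rangle$, $Z|k\rangle=\omega_d^k|k\rangle$ (arithmetic mod $d$). $V^n=\mathbb Z_d^n\times\mathbb Z_d^n$; for $p,q\in\mathbb Z_d^n$, $Z^p=\bigotimes_i Z^{p_i}$, $X^q=\bigotimes_i X^{q_i}$, and $w(p,q)=\omega_d^{-2^{-1}p\cdot q}Z^pX^q$ on $(\mathbb C^d)^{\otimes n}$, where $2^{-1}$ is the inverse of $2$ in $\mathbb Z_d$. Symplectic form: $\langle(p,q),(p',q')\rangle_s=p\cdot q'-p'\cdot q$. Characteristic function of a state $\rho$: $\Xi_\rho(z)=\operatorname{tr}[\rho\,w(-z)]$, so $\rho=d^{-n}\sum_{z\in V^n}\Xi_\rho(z)w(z)$. A linear subspace $N\subseteq V^n$ is isotropic if $\langle u,v\rangle_s=0$ for all $u,v\in N$; it is maximal isotropic iff moreover $\dim N=n$. For isotropic $N$ of dimension $k$, the stabilizer pinching is $\Delta_N(\rho)=d^{-k}\sum_{u\in N}w(u)\rho w(u)^\dagger$. The exact stabilizer skeleton of a state $\rho$ is $S_\rho=\{z\in V^n:|\Xi_\rho(z)|=1\}$; it is an isotropic linear subspace. The mean state $M(\rho)$ is the state with $\Xi_{M(\rho)}(z)=\Xi_\rho(z)$ if $z\in S_\rho$ and $\Xi_{M(\rho)}(z)=0$ otherwise. Convolutional channel. $G=\begin{pmatrix}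 g_{00} & g_{01} \\ g_{10} & g_{11} \end{pmatrix}$ is invertible over $\mathbb Z_d$, $N_G=(\det G)^{-1}\in\mathbb Z_d$, and $U_G$ is the unitary on $\mathcal H_A\otimes\mathcal H_B$, $\mathcal H_A=\mathcal H_B=(\mathbb C^d)^{\otimes n}$, with $U_G|i,j\rangle=|N_Gg_{11}i-N_Gg_{10}j,\,-N_Gg_{01}i+N_Gg_{00}j\rangle$ for $i,j\in\mathbb Z_d^n$. For a state $\sigma$ on $\mathcal H_B$, $\Lambda_\sigma(\rho)=\operatorname{tr}_B[U_G(\rho\otimes\sigma)U_G^\dagger]$. The one-shot Holevo information of a channel $\Lambda$ is $\chi(\Lambda)=\max_{\{p_i,\rho_i\}}\big[S(\Lambda(\sum_ip_i\rho_i))-\sum_ip_iS(\Lambda(\rho_i))\big]$, over finite ensembles of input states. *)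

(* Defs.v *)
From mathcomp Require Export all_boot all_order all_algebra.
From mathcomp Require Export spectral mxtens complex.
From mathcomp Require Export all_classical all_reals all_analysis.
Set Implicit Arguments.
Unset Strict Implicit.
Unset Printing Implicit Defensive.
Import Order.TTheory GRing.Theory Num.Theory.
Local Open Scope ring_scope.
Local Open Scope complex_scope.
Local Open Scope sesquilinear_scope.
Local Open Scope classical_set_scope.

Section Entropy.
Variables (R : realType) (N : nat).
Implicit Types A rho : 'M[R[i]]_N.

Definition log2 (x : R) : R := ln x / ln 2.

(* In R[i], 0 <= z means that z is real and nonnegative, so the first clause
   is positive semidefiniteness and includes Hermitian symmetry. *)
Definition is_state rho : Prop :=
  (forall v : 'cV[R[i]]_N, 0 <= (v ^t* *m rho *m v) 0 0) /\ \tr rho = 1.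

(* Functional calculus for Hermitian A = P^-1 diag(lambda) P.  As ln 0 = 0, the
   kernel of A contributes 0 to tr (A log A), i.e. 0 log 0 = 0. *)
Definition log2mx A : 'M[R[i]]_N :=
  invmx (spectralmx A)
    *m diag_mx (map_mx (fun z => (log2 (complex.Re z))%:C) (spectral_diag A))
    *m spectralmx A.

Definition entropy rho : R := - complex.Re (\tr (rho *m log2mx rho)).

End Entropy.

Definition ptrace2 (R : realType) (N M : nat) (A : 'M[R[i]]_(N * M)) :
    'M[R[i]]_N :=
  \matrix_(i, j) \sum_(k < M) A (mxtens_index (i, k)) (mxtens_index (j, k)).

Section Holevo.
Variables (R : realType) (N M : nat).

Definition is_ensemble (k : nat) (p : 'I_k -> R) (rho : 'I_k -> 'M[R[i]]_N) :
    Prop :=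
  [/\ forall i, 0 <= p i, \sum_i p i = 1 & forall i, is_state (rho i)].

Definition holevo_quantity (Lam : 'M[R[i]]_N -> 'M[R[i]]_M)
    (k : nat) (p : 'I_k -> R) (rho : 'I_k -> 'M[R[i]]_N) : R :=
  entropy (Lam (\sum_i (p i)%:C *: rho i))
  - \sum_i p i * entropy (Lam (rho i)).

Definition holevo_values (Lam : 'M[R[i]]_N -> 'M[R[i]]_M) : set R :=
  [set x | exists (k : nat) (p : 'I_k -> R) (rho : 'I_k -> 'M[R[i]]_N),
     is_ensemble p rho /\ x = holevo_quantity Lam p rho].

(* For a channel the values lie in [0, log2 M], so the supremum is the usual
   maximum over ensembles. *)
Definition holevo (Lam : 'M[R[i]]_N -> 'M[R[i]]_M) : R :=
  sup (holevo_values Lam).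

End Holevo.

Section Qudits.
Variables (R : realType) (d n : nat).
Local Notation C := R[i].

(* Z_d^n; for d prime 'F_d is Z_d. *)
Definition Zdn : finType := 'rV['F_d]_n.

(* (C^d)^{(x) n} has the basis |k>, k in Z_d^n, numbered by enum_rank; operators
   are matrices in this basis, acting on column vectors. *)
Definition hdim : nat := #|Zdn|.
Definition label (i : 'I_hdim) : 'rV['F_d]_n := enum_val i.
Definition ket (k : 'rV['F_d]_n) : 'I_hdim := @enum_rank Zdn k.

Definition phase_space : vectType 'F_d := ('rV['F_d]_n * 'rV['F_d]_n)%type.

Definition dot (p q : 'rV['F_d]_n) : 'F_d := \sum_i p 0 i * q 0 i.

Definition omega : C := cos (2 * pi / d%:R) +i* sin (2 * pi / d%:R).
Definition omega_pow (a : 'F_d) : C := omega ^+ a.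

(* One-qudit matrices are indexed by the elements of 'F_d themselves. *)
Local Notation qudit_op := 'M[C]_((Zp_trunc (pdiv d)).+2).
Definition shiftX : qudit_op :=
  \matrix_(k, l) ((k : 'F_d) == (l : 'F_d) + 1)%:R.
Definition clockZ : qudit_op := \matrix_(k, l) (omega_pow k *+ (k == l)).

Definition tensor_op (A : 'I_n -> qudit_op) : 'M[C]_hdim :=
  \matrix_(k, l) \prod_(i < n) A i (label k 0 i) (label l 0 i).

Definition Zpow (p : 'rV['F_d]_n) : 'M[C]_hdim :=
  tensor_op (fun i => clockZ ^+ (p 0 i : 'F_d)).
Definition Xpow (q : 'rV['F_d]_n) : 'M[C]_hdim :=
  tensor_op (fun i => shiftX ^+ (q 0 i : 'F_d)).

Definition weyl (z : phase_space) : 'M[C]_hdim :=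
  omega_pow (- (2%:R^-1 * dot z.1 z.2)) *: (Zpow z.1 *m Xpow z.2).

Definition symp (u v : phase_space) : 'F_d := dot u.1 v.2 - dot v.1 u.2.

Definition char_fun (rho : 'M[C]_hdim) (z : phase_space) : C :=
  \tr (rho *m weyl (- z)).

(* The operator with a given characteristic function (Weyl inversion). *)
Definition of_char_fun (xi : phase_space -> C) : 'M[C]_hdim :=
  (d%:R ^- n) *: \sum_(z : 'rV['F_d]_n * 'rV['F_d]_n) xi z *: weyl z.

Definition isotropic (M : {vspace phase_space}) : Prop :=
  forall u v, u \in M -> v \in M -> symp u v = 0.

Definition maximal_isotropic : set {vspace phase_space} :=
  [set M | isotropic M /\ \dim M = n].

Definition pinching (M : {vspace phase_space}) (rho : 'M[C]_hdim) :
    'M[C]_hdim :=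
  (d%:R ^- \dim M) *:
    \sum_(u : 'rV['F_d]_n * 'rV['F_d]_n | (u : phase_space) \in M)
       weyl u *m rho *m (weyl u) ^t*.

Definition skeleton (rho : 'M[C]_hdim) : pred phase_space :=
  [pred z | `|char_fun rho z| == 1].

Definition mean_state (rho : 'M[C]_hdim) : 'M[C]_hdim :=
  of_char_fun (fun z => if z \in skeleton rho then char_fun rho z else 0).

Definition positive_convolution (G : 'M['F_d]_2) : Prop :=
  G \in unitmx /\ forall i j, G i j != 0.

Definition conv_map (G : 'M['F_d]_2) (i j : 'rV['F_d]_n) :
    'rV['F_d]_n * 'rV['F_d]_n :=
  let NG := (\det G)^-1 in
  ((NG * G 1 1) *: i - (NG * G 1 0) *: j,
   - (NG * G 0 1) *: i + (NG * G 0 0) *: j).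

Definition conv_unitary (G : 'M['F_d]_2) : 'M[C]_(hdim * hdim) :=
  \matrix_(a, b)
    let out := conv_map G (label (mxtens_unindex b).1)
                          (label (mxtens_unindex b).2) in
    (a == mxtens_index (ket out.1, ket out.2))%:R.

Definition conv_channel (G : 'M['F_d]_2) (sigma rho : 'M[C]_hdim) :
    'M[C]_hdim :=
  ptrace2 (conv_unitary G *m (rho *t sigma) *m (conv_unitary G) ^t*).

End Qudits.

Definition is_min (R : realType) (A : set R) (m : R) : Prop :=
  A m /\ lbound A m.

(* Main.v *)
From HB Require Import structures.
Require Import Defs.
From mathcomp Require Import ring lra zify.
Set Implicit Arguments.
Unset Strict Implicit.
Unset Printing Implicit Defensive.
Import Order.TTheory GRing.Theory Num.Theory.
Local Open Scope ring_scope.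
Local Open Scope complex_scope.
Local Open Scope sesquilinear_scope.

(** A positive linear map that is unital and trace preserving does not decrease
    entropy.  For a fixed input [rho], the map [sigma |-> Lambda_sigma rho] is
    such a map, because the convolution acts on characteristic functions by
    [Xi_out z = Xi_rho (A z) * Xi_sigma (B z)] with [A] and [B] invertible and
    diagonal.  Hence every output has entropy at least [S(sigma)], which is the
    upper bound.

    For the lower bound, let [M] be maximal isotropic and probe the channel with
    the Weyl orbit of the stabilizer state whose stabilizer is [A (B^-1 M)].  The
    orbit averages to the maximally mixed state, and each output has the same
    entropy as [tau], where [Xi_tau z = [B z \in M] Xi_sigma (B z)].  Since
    positivity of [G] forces [b1 * b2 <> 1] for [B = diag (b1, b2)], another
    positive convolution has second scaling [B^-1]; applied to [tau] and a suitable
    stabilizer state it returns the pinching of [sigma], so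
    [S(tau) <= S(Delta_M sigma)].

    If [M] contains the skeleton [S], then the mean state is the Weyl twirl of
    [Delta_M sigma] over the symplectic complement of [S], so its entropy is at
    least that of [Delta_M sigma]. *)

(** * Positive semidefinite matrices *)

Section Psd.
Variable C : numClosedFieldType.

Lemma adjmxM m n p (A : 'M[C]_(m, n)) (B : 'M[C]_(n, p)) :
  (A *m B) ^t* = B ^t* *m A ^t*.
Proof. by rewrite trmx_mul map_mxM. Qed.

Lemma adjmxE m n (A : 'M[C]_(m, n)) i j : A ^t* i j = ((A j i)^*)%R.
Proof. by rewrite !mxE. Qed.

Lemma adjmxD m n (A B : 'M[C]_(m, n)) : (A + B) ^t* = A ^t* + B ^t*.
Proof. by apply/matrixP => i j; rewrite !mxE rmorphD. Qed.

Lemma adjmxZ m n (A : 'M[C]_(m, n)) c : (c *: A) ^t* = c^* *: A ^t*.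
Proof. by apply/matrixP => i j; rewrite !mxE rmorphM. Qed.

(** The first clause of [is_state], stated over any numerically closed field. *)
Definition psd n (A : 'M[C]_n) : Prop :=
  forall v : 'cV[C]_n, 0 <= (v ^t* *m A *m v) 0 0.

(* Polarization: [v^* A v] is real at [v = e_j + c e_i] for [c = 1] and [c = 'i]. *)
Lemma psd_adj n (A : 'M[C]_n) : psd A -> A ^t* = A.
Proof.
move=> hA; apply/matrixP => i j; rewrite !mxE.
pose q (c : C) := (delta_mx j 0 + c *: delta_mx i 0 : 'cV[C]_n).
have entry k l (a b : C) : (a *: delta_mx k 0 : 'cV[C]_n) ^t* *m A *m (b *: delta_mx l 0)
    = (a^* * b * A k l)%:M.
  have -> : (a *: delta_mx k 0 : 'cV[C]_n) ^t* = a^* *: delta_mx 0 k.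
    apply/matrixP => x y; rewrite !mxE rmorphM rmorph_nat andbC.
    by rewrite [x]ord1.
  rewrite -scalemxAl -scalemxAl -scalemxAr -rowE.
  apply/matrixP => x y; rewrite !ord1 !mxE /= mulr1n.
  rewrite (bigD1 l) //= !mxE !eqxx mulr1 big1 ?addr0 ?mulrA // => z /negPf zl.
  by rewrite !mxE zl mulr0.
have expand c : ((q c) ^t* *m A *m q c) 0 0 =
    A j j + c * A j i + c^* * A i j + c^* * c * A i i.
  rewrite /q -[X in (X + _) ^t*]scale1r -[X in _ *m (X + _)]scale1r.
  rewrite adjmxD !mulmxDl !mulmxDr !entry !mxE /= !mulr1n rmorph1.
  by rewrite !mul1r mulr1 !addrA.
have realq c : c * A j i + c^* * A i j \is Num.real.
  have hq := ger0_real (hA (q c)).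
  have hjj := ger0_real (hA (1 *: delta_mx j 0)).
  have hii := ger0_real (hA (c *: delta_mx i 0)).
  move: hq hjj hii; rewrite expand !entry !mxE /= !mulr1n => hq hjj hii.
  rewrite rmorph1 !mul1r in hjj.
  have -> : c * A j i + c^* * A i j = A j j + c * A j i + c^* * A i j + c^* * c * A i i
    - A j j - c^* * c * A i i by ring.
  by rewrite !rpredB.
have /CrealP := realq 1; have /CrealP := realq 'i%R.
rewrite conjCi rmorph1 !rmorphD !rmorphM /= rmorphN /= conjCi rmorph1 opprK.
rewrite !mul1r => h1 h2.
have /(mulfI (neq0Ci C)) h3 : 'i%R * (- (A j i)^* + (A i j)^*) = 'i%R * (A j i - A i j).
  by rewrite !mulrDr !mulrN -!mulNr h1 .
have h4 : 2 * (A j i)^* = 2 * A i j.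
  have -> : 2 * (A j i)^* = ((A j i)^* + (A i j)^*) - (- (A j i)^* + (A i j)^*) by ring.
  by rewrite h2 h3; ring.
by apply: (mulfI _ h4); rewrite pnatr_eq0.
Qed.

Lemma psd_spectral n (A : 'M[C]_n) : psd A ->
  A = (spectralmx A) ^t* *m diag_mx (spectral_diag A) *m spectralmx A.
Proof.
move=> /psd_adj hA; have /orthomx_spectralP : A \is normalmx.
  by apply/normalmxP; rewrite hA.
by rewrite invmx_unitary ?spectral_unitarymx.
Qed.

Lemma psd_conj m n (A : 'M[C]_n) (B : 'M[C]_(m, n)) :
  psd A -> psd (B *m A *m B ^t*).
Proof.
move=> hA v; have := hA (B ^t* *m v).
by rewrite adjmxM trmxCK !mulmxA.
Qed.

Lemma psd_diag n (A : 'M[C]_n) i : psd A -> 0 <= A i i.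
Proof.
move=> /(_ (delta_mx i 0)).
have -> : (delta_mx i 0 : 'cV[C]_n) ^t* = delta_mx 0 i.
  by rewrite trmx_delta map_delta_mx.
by rewrite -rowE -colE !mxE.
Qed.

Lemma spectral_diagE n (A : 'M[C]_n) : psd A ->
  spectralmx A *m A *m (spectralmx A) ^t* = diag_mx (spectral_diag A).
Proof.
move=> /psd_spectral hA; have /unitarymxP U := spectral_unitarymx A.
by rewrite [X in _ *m X *m _]hA !mulmxA U mul1mx -mulmxA U mulmx1.
Qed.

Lemma spectral_diag_ge0 n (A : 'M[C]_n) i : psd A -> 0 <= spectral_diag A 0 i.
Proof.
move=> hA; have := psd_diag i (psd_conj (spectralmx A) hA).
by rewrite spectral_diagE // !mxE eqxx mulr1n.
Qed.

Lemma psd0 n : psd (0 : 'M[C]_n).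
Proof. by move=> v; rewrite mulmx0 mul0mx mxE. Qed.

Lemma psdD n (A B : 'M[C]_n) : psd A -> psd B -> psd (A + B).
Proof.
by move=> hA hB v; rewrite mulmxDr mulmxDl mxE addr_ge0.
Qed.

Lemma psdZ n (A : 'M[C]_n) c : 0 <= c -> psd A -> psd (c *: A).
Proof.
by move=> hc hA v; rewrite -scalemxAr -scalemxAl mxE mulr_ge0.
Qed.

Lemma psd_sum n (I : Type) (r : seq I) (P : pred I) (F : I -> 'M[C]_n) :
  (forall i, P i -> psd (F i)) -> psd (\sum_(i <- r | P i) F i).
Proof. by move=> h; elim/big_ind: _ => //; [exact: psd0|exact: psdD]. Qed.

Lemma psd_gram m n (A : 'M[C]_(m, n)) : psd (A ^t* *m A).
Proof.
move=> v; rewrite mulmxA -mulmxA -adjmxM mxE sumr_ge0 // => k _.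
by rewrite !mxE mulrC mul_conjC_ge0.
Qed.

Lemma psd_rank1 n (w : 'cV[C]_n) : psd (w *m w ^t*).
Proof. by rewrite -{1}[w]trmxCK; apply: psd_gram. Qed.

Lemma psd1 n : psd (1%:M : 'M[C]_n).
Proof.
by have := psd_gram (1%:M : 'M[C]_n); rewrite mulmx1 trmx1 map_mx1.
Qed.

Lemma diag_conj_sum n (P : 'M[C]_n) (D : 'rV[C]_n) :
  P ^t* *m diag_mx D *m P = \sum_j D 0 j *: ((row j P) ^t* *m row j P).
Proof.
apply/matrixP => x y; rewrite summxE !mxE; apply: eq_bigr => j _.
by rewrite mul_mx_diag !mxE big_ord1 !mxE mulrAC mulrC.
Qed.

(** Spectral decomposition, each eigenvector scaled by the square root of its eigenvalue. This form
    makes positivity of the convolution visible in [conv_psd]. *)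
Lemma psd_rank1_sum n (A : 'M[C]_n) : psd A ->
  exists w : 'I_n -> 'cV[C]_n, A = \sum_j w j *m (w j) ^t*.
Proof.
move=> hA; exists (fun j => sqrtC (spectral_diag A 0 j) *: (row j (spectralmx A)) ^t*).
rewrite {1}(psd_spectral hA) diag_conj_sum; apply: eq_bigr => j _.
rewrite adjmxZ -scalemxAl -scalemxAr scalerA trmxCK.
congr (_ *: _); rewrite [X in _ * X]conj_Creal ?ger0_real ?sqrtC_ge0 ?spectral_diag_ge0 //.
by rewrite -expr2 sqrtCK.
Qed.

End Psd.

(** * Entropy and unital maps *)

Section EntropyTheory.
Variable R : realType.
Local Notation C := R[i].

Definition eta (x : R) : R := - (x * log2 x).

Lemma ln2_gt0 : 0 < ln (2 : R).
Proof. by rewrite ln_gt0 // ltr1n. Qed.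

(** Concavity as a tangent-line bound: the slope is the derivative of [eta] at [m], and the
    inequality is [ln (1 + y) <= y] at [y = m / x - 1]. At [x = 0] the gap is [m / ln 2]. *)
Lemma eta_tangent (m x : R) : 0 < m -> 0 <= x ->
  eta x <= eta m + (- (ln m + 1) / ln 2) * (x - m).
Proof.
move=> m0; rewrite le_eqVlt => /predU1P[<-|x0].
  rewrite /eta /log2 mul0r oppr0 sub0r.
  have -> : - (m * (ln m / ln 2)) + - (ln m + 1) / ln 2 * - m = m / ln 2.
    by ring.
  by rewrite divr_ge0 ?ltW ?ln2_gt0.
have := le_ln1Dx (_ : -1 < m / x - 1).
rewrite ltrBDl subrr divr_gt0 // => /(_ isT).
rewrite addrCA subrr addr0 ln_div ?posrE // => h.
rewrite /eta /log2 !mulrA -subr_ge0.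
have -> : - (m * ln m / ln 2) + - (ln m + 1) / ln 2 * (x - m) - - (x * ln x / ln 2)
  = (x * ((m / x - 1) - (ln m - ln x))) / ln 2.
  by field; rewrite !gt_eqF ?ln2_gt0.
by apply: divr_ge0; [rewrite mulr_ge0 ?subr_ge0 // ltW|exact/ltW/ln2_gt0].
Qed.

(** Averaging the tangent bounds at the mean [m] cancels the linear terms. For [m = 0] there is no
    tangent, but then every [w j * x j] vanishes. *)
Lemma eta_jensen n (w x : 'I_n -> R) :
  (forall j, 0 <= w j) -> \sum_j w j = 1 -> (forall j, 0 <= x j) ->
  \sum_j w j * eta (x j) <= eta (\sum_j w j * x j).
Proof.
move=> w0 w1 x0; set m := \sum_j w j * x j.
have : 0 <= m by apply: sumr_ge0 => j _; rewrite mulr_ge0.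
rewrite le_eqVlt => /predU1P[/esym m0|m0].
  have h j : w j * x j = 0.
    by apply: (psumr_eq0P _ m0) => // i _; rewrite mulr_ge0.
  rewrite m0 /eta mul0r oppr0 big1 // => j _.
  by rewrite mulrN mulrA h mul0r oppr0.
apply: (@le_trans _ _ (\sum_j w j * (eta m + (- (ln m + 1) / ln 2) * (x j - m)))).
  by apply: ler_sum => j _; rewrite ler_wpM2l ?eta_tangent.
rewrite le_eqVlt; apply/orP; left; apply/eqP.
set k := _ / _.
transitivity (eta m * (\sum_j w j) + k * (m - m * \sum_j w j)).
  by rewrite !mulr_sumr -sumrB mulr_sumr -big_split; apply: eq_bigr => j _ /=; ring.
by rewrite w1; ring.
Qed.

(** The matrix and its logarithm are diagonal in one eigenbasis, and positivity makes the
    eigenvalues real. *)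
Lemma entropy_spectral N (A : 'M[C]_N) : psd A ->
  entropy A = \sum_i eta (complex.Re (spectral_diag A 0 i)).
Proof.
move=> hA; rewrite /entropy /log2mx.
set L := map_mx _ _; rewrite invmx_unitary ?spectral_unitarymx //.
set P := spectralmx A; set D := spectral_diag A.
have hAE : A = P ^t* *m diag_mx D *m P := psd_spectral hA.
have /unitarymxP U : P \is unitarymx := spectral_unitarymx A.
rewrite {1}hAE !mulmxA -(mulmxA _ P) U mulmx1 mxtrace_mulC !mulmxA U mul1mx.
rewrite mulmx_diag mxtrace_diag raddf_sum -sumrN; apply: eq_bigr => i _.
rewrite /eta !mxE; congr (- _).
have /ger0_Im : 0 <= D 0 i := spectral_diag_ge0 i hA.
by case: (D 0 i) => a b /= ->; rewrite !mul0r subr0.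
Qed.

(* In the eigenbases of [A] and [Phi A], the matrix [B] below is doubly stochastic
   and maps the spectrum of [A] to that of [Phi A]. *)
Lemma entropy_psd_unital_le N (Phi : 'M[C]_N -> 'M[C]_N) (A : 'M[C]_N) :
  linear Phi -> (forall X, psd X -> psd (Phi X)) ->
  (forall X, \tr (Phi X) = \tr X) -> Phi 1%:M = 1%:M ->
  psd A -> entropy A <= entropy (Phi A).
Proof.
move=> linPhi posPhi trPhi Phi1 hA.
have Phi0 : Phi 0 = 0.
  by have := linPhi (-1) 0 0; rewrite scaler0 addr0 scaleN1r addNr.
have Phisum (c : 'I_N -> C) (F : 'I_N -> 'M[C]_N) :
    Phi (\sum_j c j *: F j) = \sum_j c j *: Phi (F j).
  by elim/big_rec2: _ => // j y1 y2 _ <-; rewrite linPhi.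
have hPA := posPhi _ hA.
rewrite !entropy_spectral //.
set l := spectral_diag A; set m := spectral_diag (Phi A).
set P := spectralmx A; set Q := spectralmx (Phi A).
pose E j := (row j P) ^t* *m row j P.
(* Weight of the image of the [j]-th eigenprojection of [A] on the [i]-th eigenvector of [Phi A]. *)
pose B i j := (Q *m Phi (E j) *m Q ^t*) i i.
have UQ : Q *m Q ^t* = 1%:M by apply/unitarymxP/spectral_unitarymx.
have UP : P ^t* *m P = 1%:M by apply/mulmx1C/unitarymxP/spectral_unitarymx.
have psdE j : psd (E j) by exact: psd_gram.
have B0 i j : 0 <= B i j by apply/psd_diag/psd_conj/posPhi/psdE.
have Bre i j : (complex.Re (B i j))%:C = B i j by rewrite RRe_real ?ger0_real.
have mE i : m 0 i = \sum_j l 0 j * B i j.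
  have /(congr1 (fun X : 'M[C]_N => X i i)) := spectral_diagE hPA.
  rewrite [in RHS]mxE eqxx mulr1n -/m => <-; rewrite -/Q.
  rewrite {1}(psd_spectral hA) diag_conj_sum Phisum mulmx_sumr mulmx_suml summxE.
  by apply: eq_bigr => j _; rewrite -scalemxAr -scalemxAl mxE.
(* Row sums: the eigenprojections add up to the identity, which [Phi] fixes. *)
have Brow i : \sum_j B i j = 1.
  have h1 : (Q *m Phi 1%:M *m Q ^t*) i i = 1 by rewrite Phi1 mulmx1 UQ mxE eqxx.
  have PP : 1%:M = P ^t* *m diag_mx (const_mx 1) *m P.
    by rewrite diag_const_mx mulmx1 UP.
  rewrite -[RHS]h1 PP diag_conj_sum Phisum mulmx_sumr mulmx_suml summxE.
  by apply: eq_bigr => j _; rewrite [const_mx _ _ _]mxE scale1r.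
(* Column sums: [Phi] preserves the unit trace of each eigenprojection. *)
have Bcol j : \sum_i B i j = 1.
  have -> : \sum_i B i j = \tr (Q *m Phi (E j) *m Q ^t*) by [].
  rewrite -mulmxA mxtrace_mulC -mulmxA (mulmx1C UQ) mulmx1 trPhi /E mxtrace_mulC.
  have /matrixP/(_ j j) : P *m P ^t* = 1%:M by exact: mulmx1C.
  rewrite [RHS]mxE eqxx mulr1n => <-; rewrite /mxtrace big_ord1 !mxE.
  by apply: eq_bigr => k _; rewrite !mxE.
have l0 j : 0 <= complex.Re (l 0 j).
  by rewrite -ler0c RRe_real ?ger0_real ?spectral_diag_ge0.
have ReB0 i j : 0 <= complex.Re (B i j) by rewrite -ler0c Bre.
have ReBrow i : \sum_j complex.Re (B i j) = 1.
  by apply: (@complexI R); rewrite rmorph1 -(Brow i) rmorph_sum; apply: eq_bigr => j _; exact: Bre.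
have ReBcol j : \sum_i complex.Re (B i j) = 1.
  by apply: (@complexI R); rewrite rmorph1 -(Bcol j) rmorph_sum; apply: eq_bigr => i _; exact: Bre.
have RemE i : complex.Re (m 0 i) = \sum_j complex.Re (B i j) * complex.Re (l 0 j).
  rewrite mE raddf_sum; apply: eq_bigr => j _.
  have := ger0_Im (B0 i j); have : complex.Im (l 0 j) = 0.
    by apply/ger0_Im/spectral_diag_ge0.
  case: (B i j) (l 0 j) => a b [a' b'] /= -> ->.
  by rewrite mulr0 subr0 mulrC.
(* Column sums spread each [eta] term over the rows; row sums then allow Jensen in every row. *)
have -> : \sum_j eta (complex.Re (l 0 j)) =
    \sum_i \sum_j complex.Re (B i j) * eta (complex.Re (l 0 j)).
  rewrite exchange_big; apply: eq_bigr => j _.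
  by rewrite -mulr_suml ReBcol mul1r.
by apply: ler_sum => i _; rewrite RemE eta_jensen.
Qed.

Lemma entropy_maximally_mixed N : (0 < N)%N ->
  entropy ((N%:R^-1)%:M : 'M[C]_N) = log2 N%:R.
Proof.
move=> N0; have NN : (N%:R : R) != 0 by rewrite pnatr_eq0 -lt0n.
have hA : psd ((N%:R^-1)%:M : 'M[C]_N).
  by rewrite -scalemx1; apply: psdZ; [rewrite invr_ge0 ler0n|exact: psd1].
rewrite entropy_spectral //.
have lE i : spectral_diag ((N%:R^-1)%:M : 'M[C]_N) 0 i = (N%:R^-1 : R)%:C.
  have /(congr1 (fun X : 'M[C]_N => X i i)) := spectral_diagE hA.
  have /unitarymxP U := spectral_unitarymx ((N%:R^-1)%:M : 'M[C]_N).
  rewrite mul_mx_scalar -scalemxAl U !mxE eqxx !mulr1n mulr1 => <-.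
  by rewrite fmorphV rmorph_nat.
under eq_bigr do rewrite lE /=.
rewrite sumr_const card_ord /eta /log2 lnV ?posrE ?ltr0n //.
rewrite mulNr mulrN opprK -mulrnAl -[_^-1 *+ N]mulr_natr mulVf //.
by rewrite mul1r.
Qed.

(** The completely depolarizing map is positive, unital and trace preserving, and sends every state
    to the maximally mixed one. *)
Lemma entropy_le_log N (A : 'M[C]_N) : is_state A -> entropy A <= log2 N%:R.
Proof.
case=> psdA trA.
have N0 : (0 < N)%N.
  case: N A psdA trA => // A _ /eqP.
  by rewrite /mxtrace big_ord0 eq_sym oner_eq0.
have NN : (N%:R : C) != 0 by rewrite pnatr_eq0 -lt0n.
rewrite -(entropy_maximally_mixed N0).
pose Phi (X : 'M[C]_N) : 'M[C]_N := (\tr X / N%:R)%:M.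
have -> : (N%:R^-1)%:M = Phi A by rewrite /Phi trA mul1r.
apply: (@entropy_psd_unital_le N Phi A _ _ _ _ psdA).
- move=> a X Y; rewrite /Phi linearP /= mulrDl -mulrA.
  by rewrite raddfD /= scale_scalar_mx.
- move=> X hX; rewrite /Phi -scalemx1; apply: psdZ; last exact: psd1.
  by rewrite divr_ge0 ?ler0n // sumr_ge0 // => i _; apply: psd_diag.
- by move=> X; rewrite /Phi mxtrace_scalar -[LHS]mulr_natr divfK.
- by rewrite /Phi mxtrace1 divff.
Qed.

End EntropyTheory.

(** * Characters of the prime field *)

Section Characters.
Variables (R : realType) (d : nat).
Hypothesis d_prime : prime d.
Local Notation C := R[i].
Local Notation chi := (@omega_pow R d).

Lemma omegaX k : omega R d ^+ k =
  cos ((2 * pi / d%:R) *+ k) +i* sin ((2 * pi / d%:R) *+ k).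
Proof.
elim: k => [|k IH]; first by rewrite expr0 !mulr0n cos0 sin0.
rewrite exprS IH /omega [_ *+ k.+1]mulrS cosD sinD.
by congr Complex; rewrite addrC mulrC [in X in _ + X]mulrC.
Qed.

Lemma d_neq0 : (d%:R : R) != 0.
Proof. by rewrite pnatr_eq0 -lt0n prime_gt0. Qed.

Lemma omegaXd : omega R d ^+ d = 1.
Proof.
rewrite omegaX -mulr_natr divfK ?d_neq0 // mulr_natl cos2pi sin2pi.
by [].
Qed.

Lemma omegaX_mod k : omega R d ^+ (k %% d) = omega R d ^+ k.
Proof. by rewrite [in RHS](divn_eq k d) exprD mulnC exprM omegaXd expr1n mul1r. Qed.

(** With [y = pi k / d], the equality [cos (2 y) = 1] would force [sin y = 0], although
    [0 < y < pi]. *)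
Lemma omegaX_neq1 k : (0 < k < d)%N -> omega R d ^+ k != 1.
Proof.
move=> /andP[k0 kd]; apply/eqP; rewrite omegaX => -[].
pose y : R := pi / d%:R *+ k.
have -> : (2 * pi / d%:R) *+ k = y *+ 2 :> R.
  by rewrite -[LHS]mulr_natr -[RHS]mulr_natr /y -mulr_natr; ring.
rewrite cos_mulr2n cos2sin2 => hcos _.
have : sin y ^+ 2 = 0.
  by move: hcos; rewrite -mulr_natr; lra.
have d0 : (0 : R) < d%:R by rewrite ltr0n prime_gt0.
have siny : 0 < sin y.
  apply: sin_gt0_pi; rewrite /y -mulr_natr mulrAC.
  apply/andP; split; first by rewrite divr_gt0 // mulr_gt0 ?pi_gt0 // ltr0n.
  by rewrite ltr_pdivrMr // ltr_pM2l ?pi_gt0 // ltr_nat.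
by move/eqP; rewrite sqrf_eq0 gt_eqF.
Qed.

Lemma chi0 : chi 0 = 1.
Proof. by []. Qed.

(** The exponent is a natural representative; reducing it modulo [d] is harmless because [omega] has
    [d]-th power one. *)
Lemma chiD a b : chi (a + b) = chi a * chi b.
Proof.
rewrite /omega_pow -exprD -[RHS]omegaX_mod; congr (_ ^+ _).
by rewrite /= {3}(Fp_cast d_prime).
Qed.

Lemma chiN_mul a : chi a * chi (- a) = 1.
Proof. by rewrite -chiD subrr. Qed.

Lemma chiX a k : chi a ^+ k = chi (a *+ k).
Proof. by elim: k => // k IH; rewrite exprS IH -chiD mulrS. Qed.

Lemma chi_eq1 a : (chi a == 1) = (a == 0).
Proof.
apply/idP/eqP => [|->]; last by rewrite chi0.
apply: contraTeq => a0; apply: omegaX_neq1.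
rewrite lt0n; apply/andP; split; first by apply: contra a0 => /eqP h; apply/eqP/val_inj.
by have := ltn_ord a; rewrite [X in (_ < X)%N -> _]Fp_cast.
Qed.

Lemma norm_omega : `|omega R d| = 1.
Proof.
by rewrite normc_def /omega cos2Dsin2 sqrtr1.
Qed.

Lemma norm_chi a : `|chi a| = 1.
Proof. by rewrite normrX norm_omega expr1n. Qed.

Lemma chi_neq0 a : chi a != 0.
Proof. by rewrite -normr_eq0 norm_chi oner_eq0. Qed.

Lemma conj_chi a : ((chi a)^*)%R = chi (- a).
Proof.
apply: (mulfI (chi_neq0 a)); rewrite chiN_mul -[RHS](expr1n _ 2) -(norm_chi a).
by rewrite normCK.
Qed.

(** Additive subgroups as finite sets, convenient for counting and character sums; in phase space
    they are exactly the subspaces ([vspace_of_subgroup]). *)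
Definition subgroup_set (T : finZmodType) (A : {set T}) :=
  0 \in A /\ forall x y, x \in A -> y \in A -> x - y \in A.

(* Translating by [w] multiplies the sum by [chi (f w)]. *)
Lemma sum_chi (T : finZmodType) (A : {set T}) (f : T -> 'F_d) :
  subgroup_set A -> {morph f : x y / x + y} ->
  \sum_(x in A) chi (f x) = if [forall x in A, f x == 0] then #|A|%:R else 0.
Proof.
move=> [A0 AB] fD; case: ifPn => [/forall_inP h|].
  by rewrite (eq_bigr (fun _ => 1)) ?sumr_const // => x /h/eqP ->.
rewrite negb_forall_in => /exists_inP[w wA fw].
have AN y : y \in A -> - y \in A by move=> hy; rewrite -sub0r AB.
have shift : \sum_(x in A) chi (f x) = chi (f w) * \sum_(x in A) chi (f x).
  rewrite mulr_sumr (reindex_inj (addrI w)) /=; apply: eq_big => [x|x _].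
    apply/idP/idP => [h|h]; last by rewrite -[w]opprK addrC AB ?AN.
    by rewrite -[x](addKr w) addrC AB.
  by rewrite fD chiD.
move/eqP: shift; rewrite -subr_eq0 -{1}[X in X - _]mul1r -mulrBl mulf_eq0.
by rewrite subr_eq0 eq_sym chi_eq1 (negPf fw) => /eqP.
Qed.

End Characters.

(** * Weyl operators *)

Section Dot.
Variables (d n : nat).
Implicit Types p q r : 'rV['F_d]_n.

Lemma dotC p q : dot p q = dot q p.
Proof. by apply: eq_bigr => i _; rewrite mulrC. Qed.

Lemma dotDl p q r : dot (p + q) r = dot p r + dot q r.
Proof. by rewrite -big_split; apply: eq_bigr => i _; rewrite !mxE mulrDl. Qed.

Lemma dotDr p q r : dot r (p + q) = dot r p + dot r q.
Proof. by rewrite dotC dotDl dotC [dot q r]dotC. Qed.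

Lemma dotZl a p q : dot (a *: p) q = a * dot p q.
Proof. by rewrite mulr_sumr; apply: eq_bigr => i _; rewrite !mxE mulrA. Qed.

Lemma dotZr a p q : dot p (a *: q) = a * dot p q.
Proof. by rewrite dotC dotZl dotC. Qed.

Lemma dot0l p : dot 0 p = 0.
Proof. by rewrite -(scale0r p) dotZl mul0r. Qed.

Lemma dotNl p q : dot (- p) q = - dot p q.
Proof. by rewrite -scaleN1r dotZl mulN1r. Qed.

Lemma dotNr p q : dot p (- q) = - dot p q.
Proof. by rewrite dotC dotNl dotC. Qed.

Definition dotE := (dotDl, dotDr, dotZl, dotZr, dotNl, dotNr).

Lemma dot_delta p i : dot p (delta_mx 0 i) = p 0 i.
Proof.
rewrite /dot (bigD1 i) //= !mxE !eqxx mulr1 big1 ?addr0 // => j /negPf ji.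
by rewrite !mxE ji mulr0.
Qed.

Local Notation V := ('rV['F_d]_n * 'rV['F_d]_n)%type.
Implicit Types u v w : V.

Lemma symp_antisym u v : symp u v = - symp v u.
Proof. by rewrite /symp opprB. Qed.

Lemma sympDl u v w : symp (u + v : V) w = symp u w + symp v w.
Proof. by rewrite /symp /= !dotE; ring. Qed.

Lemma sympNl u v : symp (- u : V) v = - symp u v.
Proof. by rewrite /symp /= !dotE; ring. Qed.

Lemma sympDr u v w : symp w (u + v : V) = symp w u + symp w v.
Proof. by rewrite /symp /= !dotE; ring. Qed.

Lemma sympNr u v : symp u (- v : V) = - symp u v.
Proof. by rewrite /symp /= !dotE; ring. Qed.

Lemma sympvv u : symp u u = 0.
Proof. by rewrite /symp subrr. Qed.

Lemma symp_nondegenerate u : (forall v, symp u v = 0) -> u = 0.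
Proof.
case: u => p q h; congr (_, _); apply/rowP => i; rewrite mxE.
  by have := h (0, delta_mx 0 i); rewrite /symp /= dot_delta -(scale0r q) dotZl mul0r subr0.
have := h (delta_mx 0 i, 0); rewrite /symp /= [dot _ q]dotC dot_delta -(scale0r q) dotZr.
by rewrite mul0r sub0r => /eqP; rewrite oppr_eq0 => /eqP.
Qed.

End Dot.

Section Weyl.
Variables (R : realType) (d n : nat).
Hypothesis d_prime : prime d.
Hypothesis d_odd : odd d.
Local Notation C := R[i].
Local Notation chi := (@omega_pow R d).
Local Notation N := (hdim d n).
Local Notation V := ('rV['F_d]_n * 'rV['F_d]_n)%type.
Local Notation "2^-1" := ((2%:R : 'F_d)^-1).
Implicit Types (x y : 'rV['F_d]_n) (u v z : V) (X Y rho : 'M[C]_N).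

Lemma ketK : cancel (@ket d n) (@label d n).
Proof. exact: enum_rankK. Qed.

Lemma labelK : cancel (@label d n) (@ket d n).
Proof. exact: enum_valK. Qed.

Lemma sum_ket (F : 'I_N -> C) : \sum_i F i = \sum_x F (ket x).
Proof. by apply: reindex; exists (@label d n) => ? _; rewrite (ketK, labelK). Qed.

Lemma hdimE : N = (d ^ n)%N.
Proof. by rewrite /hdim card_mx card_Fp // mul1n. Qed.

(** Oddness of [d] makes 2 invertible in the field. *)
Lemma half_half : 2^-1 + 2^-1 = 1.
Proof.
have two : (2%:R : 'F_d) != 0.
  have := pchar_Fp d_prime => /dvdn_pcharf/(_ 2%N) <-.
  by apply/negP => /dvdn_leq => /(_ isT); case: (d) d_prime d_odd => [|[|[|]]].
by rewrite -[LHS]mulr2n -[LHS]mulr_natr mulVf.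
Qed.

Lemma prod_bool (I : finType) (b : I -> bool) :
  \prod_i (b i)%:R = [forall i, b i]%:R :> C.
Proof.
case: forallP => [h|/forallP]; first by rewrite big1 // => i _; rewrite h.
by rewrite negb_forall => /existsP[i /negPf h]; rewrite (bigD1 i) //= h mul0r.
Qed.

Lemma clockZX m k l :
  ((clockZ R d) ^+ m) k l = chi (k : 'F_d) ^+ m * (k == l)%:R.
Proof.
elim: m k l => [|m IH] k l; first by rewrite !expr0 mxE mul1r.
rewrite !exprS mxE (bigD1 k) //= mxE eqxx IH mulrA big1 ?addr0 // => j jk.
by rewrite !mxE eq_sym (negPf jk) mul0r.
Qed.

Lemma shiftXX m k l :
  ((shiftX R d) ^+ m) k l = ((k : 'F_d) == l + m%:R)%:R.
Proof.
elim: m k l => [|m IH] k l; first by rewrite expr0 mxE addr0.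
rewrite exprSr mxE (bigD1 (l + 1 : 'F_d)) //= mxE eqxx IH mulr1 big1 ?addr0.
  by rewrite -addrA -natr1 [m%:R + 1]addrC.
by move=> j jk; rewrite !mxE (negPf jk) mulr0.
Qed.

Lemma ZpowE p x y :
  Zpow R p (ket x) (ket y) = chi (dot p x) * (x == y)%:R.
Proof.
rewrite /Zpow /tensor_op mxE !ketK.
under eq_bigr do rewrite clockZX (chiX R d_prime).
rewrite big_split prod_bool /=; congr (_ * _).
  rewrite /dot; elim/big_rec2: _ => //= i a b _ ->.
  rewrite (chiD R d_prime) //; congr (chi _ * _).
  by rewrite -mulr_natr natr_Zp mulrC.
congr (_%:R); congr nat_of_bool; apply/forallP/eqP => [h|-> //].
by apply/rowP => i; apply/eqP.
Qed.

Lemma XpowE q x y : Xpow R q (ket x) (ket y) = (x == y + q)%:R.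
Proof.
rewrite /Xpow /tensor_op mxE !ketK.
under eq_bigr do rewrite shiftXX natr_Zp.
rewrite prod_bool; congr (_%:R); congr nat_of_bool; apply/forallP/eqP => [h|-> i].
  by apply/rowP => i; rewrite mxE; apply/eqP.
by rewrite mxE.
Qed.

Lemma weylE z x y : weyl R z (ket x) (ket y) =
  chi (- (2^-1 * dot z.1 z.2) + dot z.1 x) * (x == y + z.2)%:R.
Proof.
rewrite /weyl 2!mxE sum_ket (bigD1 x) //= ZpowE XpowE eqxx mulr1 big1.
  by rewrite addr0 (chiD R d_prime) mulrA.
by move=> k kx; rewrite ZpowE eq_sym (negPf kx) mulr0 mul0r.
Qed.

Lemma ket_matrixP X Y :
  (forall x y, X (ket x) (ket y) = Y (ket x) (ket y)) -> X = Y.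
Proof. by move=> h; apply/matrixP => i j; rewrite -(labelK i) -(labelK j). Qed.

Lemma weyl0 : weyl R (0 : V) = 1%:M.
Proof.
apply: ket_matrixP => x y; rewrite weylE !mxE /= addr0 (can_eq ketK).
by rewrite !dot0l mulr0 oppr0 addr0 chi0 mul1r.
Qed.

(** The phase in [weyl] is normalized so that the cocycle depends on the symplectic form alone; on
    isotropic subgroups [weyl] is thus a homomorphism. *)
Lemma weylM u v : weyl R u *m weyl R v = chi (2^-1 * symp u v) *: weyl R (u + v : V).
Proof.
apply: ket_matrixP => x y; rewrite 2!mxE sum_ket (bigD1 (x - u.2)) //= big1.
  rewrite !weylE subrK eqxx mulr1 addr0 subr_eq -addrA [v.2 + u.2]addrC.
  rewrite !mulrA -!(chiD R d_prime); congr (chi _ * _).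
  rewrite /symp /= !dotE.
  have := half_half; set h := 2^-1 => hh.
  set a := dot u.1 u.2; set b := dot u.1 v.2; set c := dot v.1 u.2; set e := dot v.1 v.2.
  apply/eqP; rewrite -subr_eq0; apply/eqP.
  by transitivity (c * (h + h - 1)); [ring|rewrite hh subrr mulr0].
by move=> k kx; rewrite weylE -subr_eq eq_sym (negPf kx) mulr0 mul0r.
Qed.

Lemma weyl_adj z : (weyl R z) ^t* = weyl R (- z : V).
Proof.
apply: ket_matrixP => x y; rewrite 2!mxE !weylE rmorphM rmorph_nat.
rewrite /= (conj_chi R d_prime) -subr_eq eq_sym.
have [->|_] := eqVneq x (y - z.2); last by rewrite !mulr0.
congr (chi _ * _); rewrite /= !dotE.
have := half_half; set h := 2^-1 => hh; set a := dot z.1 z.2.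
apply/eqP; rewrite -subr_eq0; apply/eqP.
by transitivity (a * (h + h - 1)); [ring|rewrite hh subrr mulr0].
Qed.

(** Each column of a Weyl operator has one nonzero entry. Fourier inversion and the convolution
    formula start from this sum. *)
Lemma mxtrace_mul_weyl X z : \tr (X *m weyl R z) =
  \sum_x X (ket x) (ket (x + z.2)) * chi (2^-1 * dot z.1 z.2 + dot z.1 x).
Proof.
rewrite /mxtrace sum_ket; apply: eq_bigr => x _.
rewrite mxE sum_ket (bigD1 (x + z.2)) //= big1 ?addr0.
  rewrite weylE eqxx mulr1; congr (_ * chi _); rewrite dotDr.
  have := half_half; set h := 2^-1 => hh; set a := dot z.1 z.2.
  apply/eqP; rewrite -subr_eq0; apply/eqP.
  by transitivity (a * (1 - (h + h))); [ring|rewrite hh subrr mulr0].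
by move=> k kx; rewrite weylE (negPf kx) !mulr0.
Qed.

Lemma subgroup_setT (T : finZmodType) : subgroup_set [set: T].
Proof. by split=> *; rewrite inE. Qed.

Lemma sum_chi_dot x : \sum_p chi (dot p x) = if x == 0 then N%:R else 0.
Proof.
have := @sum_chi R d d_prime _ [set: 'rV['F_d]_n] (fun p => dot p x)
  (@subgroup_setT _) (fun p q => dotDl p q x).
under eq_bigl do rewrite inE.
move=> ->; rewrite cardsT; congr (if _ then _ else _).
apply/forall_inP/eqP => [h|-> p _]; last by rewrite dotC dot0l.
by apply/rowP => i; rewrite mxE -dot_delta dotC; apply/eqP/h; rewrite inE.
Qed.

(* Fourier inversion in the first component of [z] recovers the entries of [X]. *)
Lemma weyl_char_inj X Y :
  (forall z, \tr (X *m weyl R z) = \tr (Y *m weyl R z)) -> X = Y.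
Proof.
have key A y q : \sum_p chi (- (2^-1 * dot p q + dot p y)) * \tr (A *m weyl R (p, q))
    = N%:R * A (ket y) (ket (y + q)).
  under eq_bigr do rewrite mxtrace_mul_weyl mulr_sumr /=.
  rewrite exchange_big (bigD1 y) //= [X in _ + X]big1 ?addr0 => [|x xy].
    under eq_bigr do rewrite mulrCA -(chiD R d_prime) addNr chi0 mulr1.
    by rewrite sumr_const mulr_natl.
  transitivity (A (ket x) (ket (x + q)) * \sum_p chi (dot p (x - y))).
    rewrite mulr_sumr; apply: eq_bigr => p _.
    rewrite mulrCA -(chiD R d_prime) dotDr dotNr; congr (_ * chi _); ring.
  by rewrite sum_chi_dot subr_eq0 (negPf xy) mulr0.
move=> h; apply: ket_matrixP => x y.
have N0 : (N%:R : C) != 0 by rewrite pnatr_eq0 hdimE -lt0n expn_gt0 prime_gt0.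
apply: (mulfI N0); have -> : y = x + (y - x) by rewrite addrC subrK.
by rewrite -!key; apply: eq_bigr => p _; rewrite h.
Qed.

Lemma mxtrace_mul_weyl_linear a X Y z :
  \tr ((a *: X + Y) *m weyl R z) = a * \tr (X *m weyl R z) + \tr (Y *m weyl R z).
Proof. by rewrite mulmxDl -scalemxAl mxtraceD mxtraceZ. Qed.

Lemma mxtrace_weyl z : \tr (weyl R z) = if z == 0 then N%:R else 0.
Proof.
case: (eqVneq z 0) => [->|]; first by rewrite weyl0 mxtrace1.
case: z => p q pq; rewrite -[weyl _ _]mul1mx mxtrace_mul_weyl /=.
have [q0|q0] := eqVneq q 0.
  rewrite (eq_bigr (fun x => chi (dot x p))) => [|x _].
    rewrite sum_chi_dot; case: eqP => // p0.
    by move: pq; rewrite p0 q0 eqxx.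
  by rewrite q0 addr0 mxE eqxx mul1r [dot p 0]dotC dot0l mulr0 add0r dotC.
rewrite big1 // => x _; rewrite mxE (can_eq ketK) -subr_eq0 opprD addrA subrr sub0r.
by rewrite oppr_eq0 (negPf q0) mul0r.
Qed.

Lemma weyl_unitary z : weyl R z *m (weyl R z) ^t* = 1%:M.
Proof. by rewrite weyl_adj weylM sympNr sympvv oppr0 mulr0 chi0 scale1r subrr weyl0. Qed.

Lemma weyl_unitaryV z : (weyl R z) ^t* *m weyl R z = 1%:M.
Proof. exact/mulmx1C/weyl_unitary. Qed.

Lemma weyl_conj u z :
  (weyl R u) ^t* *m weyl R z *m weyl R u = chi (symp z u) *: weyl R z.
Proof.
rewrite weyl_adj weylM -scalemxAl weylM scalerA -(chiD R d_prime).
congr (chi _ *: weyl R _); last by rewrite addrAC addNr add0r.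
rewrite sympDl !sympNl sympvv oppr0 add0r (symp_antisym u z) opprK -mulrDr.
by rewrite mulrDr -mulrDl half_half mul1r.
Qed.

(** Traces against [weyl R z] are characteristic functions at [- z]; a Weyl conjugation only
    multiplies them by a character. *)
Lemma mxtrace_weyl_conj X u z :
  \tr (weyl R u *m X *m (weyl R u) ^t* *m weyl R z) =
  chi (symp z u) * \tr (X *m weyl R z).
Proof.
rewrite -!mulmxA mxtrace_mulC -!mulmxA [in LHS]mulmxA.
by rewrite -linearZ /= scalemxAr -weyl_conj !mulmxA.
Qed.

End Weyl.

(** * Isotropic subgroups, twirls and stabilizer states *)

(** Joins the finite and additive structures on products, so that [sum_chi] applies to phase
    space. *)
HB.instance Definition _ (T1 T2 : finZmodType) :=
  GRing.Zmodule.on (T1 * T2)%type.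

Section Subgroups.
Variables (R : realType) (d n : nat).
Hypothesis d_prime : prime d.
Hypothesis d_odd : odd d.
Local Notation C := R[i].
Local Notation chi := (@omega_pow R d).
Local Notation N := (hdim d n).
Local Notation V := ('rV['F_d]_n * 'rV['F_d]_n)%type.
Implicit Types (u v z : V) (X Y rho : 'M[C]_N) (A : {set V}).

Definition perp A : {set V} := [set z | [forall u in A, symp z u == 0]].

Definition isotropic_set A := forall u v, u \in A -> v \in A -> symp u v = 0.

Lemma perpP A z : reflect (forall u, u \in A -> symp z u = 0) (z \in perp A).
Proof.
by rewrite inE; apply: (iffP forall_inP) => h u uA; apply/eqP/h.
Qed.

Lemma subgroup_perp A : subgroup_set (perp A).
Proof.
split=> [|x y /perpP hx /perpP hy]; apply/perpP => u uA.
  by rewrite -(subrr u) sympDl sympNl subrr.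
by rewrite sympDl sympNl hx ?hy ?subrr.
Qed.

Lemma sum_chi_symp A z : subgroup_set A ->
  \sum_(u in A) chi (symp z u) = if z \in perp A then #|A|%:R else 0.
Proof.
move=> hA; rewrite inE.
exact: (@sum_chi R d d_prime _ A (fun u => symp z u) hA (fun u v => sympDr u v z)).
Qed.

Lemma card_phase_space : #|[set: V]| = (N * N)%N.
Proof. by rewrite cardsT card_prod. Qed.

Lemma perpT : perp [set: V] = [set 0].
Proof.
apply/setP => z; rewrite finset.in_set1; apply/perpP/eqP => [h|-> u _].
  by apply: symp_nondegenerate => v; apply: h; rewrite inE.
by rewrite -(subrr u) sympDl sympNl subrr.
Qed.

(* Double counting of [\sum_z \sum_(u in A) chi (symp z u)]. *)
Lemma card_perp A : subgroup_set A -> (#|A| * #|perp A|)%N = (N * N)%N.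
Proof.
move=> hA; apply/eqP; rewrite -(eqr_nat C) natrM; apply/eqP.
transitivity (\sum_z \sum_(u in A) chi (symp z u)).
  under eq_bigr do rewrite sum_chi_symp //.
  by rewrite -big_mkcond sumr_const mulr_natr.
rewrite exchange_big (bigD1 0) /=; last by case: hA.
rewrite [X in _ + X]big1 ?addr0.
  under eq_bigr => z _ do rewrite -(subrr z) sympDr sympNr subrr chi0.
  by rewrite sumr_const -card_phase_space cardsT.
move=> u /andP[_ u0].
under eq_bigr => z _ do rewrite symp_antisym -sympNl.
have := sum_chi_symp (- u) (subgroup_setT V).
rewrite perpT finset.in_set1 oppr_eq0 (negPf u0) => h; rewrite -[RHS]h.
by apply: eq_bigl => z; rewrite finset.in_setT.
Qed.

(** One inclusion is antisymmetry of the form; applying [card_perp] to [A] and to [perp A] shows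
    that the sizes agree. *)
Lemma perpK A : subgroup_set A -> perp (perp A) = A.
Proof.
move=> hA; apply/esym/eqP; rewrite eqEcard; apply/andP; split.
  apply/fintype.subsetP => u uA; apply/perpP => z /perpP/(_ u uA).
  by rewrite symp_antisym => /eqP; rewrite oppr_eq0 => /eqP.
have h1 := card_perp hA; have h2 := card_perp (subgroup_perp A).
have N0 : (0 < N * N)%N by rewrite (hdimE n d_prime) muln_gt0 !expn_gt0 prime_gt0.
have p0 : (0 < #|perp A|)%N by move: N0; rewrite -h1 muln_gt0 => /andP[].
by rewrite -(leq_pmul2l p0) h2 -h1 mulnC.
Qed.

Lemma isotropic_subset_perp A : isotropic_set A -> A \subset perp A.
Proof. by move=> h; apply/fintype.subsetP => u uA; apply/perpP => v vA; apply: h. Qed.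

(** Isotropy gives an inclusion, and [card_perp] gives both sides [N] elements. *)
Lemma perp_lagrangian A : subgroup_set A -> isotropic_set A -> #|A| = N ->
  perp A = A.
Proof.
move=> hA iA cA; apply/esym/eqP; rewrite eqEcard isotropic_subset_perp //=.
have N0 : (0 < N)%N by rewrite (hdimE n d_prime) expn_gt0 prime_gt0.
by have := card_perp hA; rewrite cA => /eqP; rewrite eqn_pmul2l // => /eqP ->.
Qed.

(** The pinching formula for an arbitrary subgroup; it is also applied to the whole phase space and
    to the complement of the skeleton. *)
Definition twirl A X : 'M[C]_N :=
  (#|A|%:R)^-1 *: \sum_(u in A) weyl R u *m X *m (weyl R u) ^t*.

Lemma card_subgroup_neq0 A : subgroup_set A -> (#|A|%:R : C) != 0.
Proof. by case=> A0 _; rewrite pnatr_eq0 -lt0n; apply/card_gt0P; exists 0. Qed.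

(** Orthogonality of characters: averaging the phases of the conjugations leaves exactly the
    symplectic complement. *)
Lemma mxtrace_twirl A X z : subgroup_set A ->
  \tr (twirl A X *m weyl R z) = if z \in perp A then \tr (X *m weyl R z) else 0.
Proof.
move=> hA; rewrite /twirl -scalemxAl mxtraceZ mulmx_suml raddf_sum /=.
under eq_bigr do rewrite mxtrace_weyl_conj //.
rewrite -mulr_suml sum_chi_symp //.
by case: ifP => _; rewrite ?mul0r ?mulr0 // mulKf ?card_subgroup_neq0.
Qed.

Lemma mxtrace_weyl0 X : \tr X = \tr (X *m weyl R (0 : V)).
Proof. by rewrite weyl0 // mulmx1. Qed.

Lemma entropy_twirl A X : subgroup_set A -> psd X -> entropy X <= entropy (twirl A X).
Proof.
move=> hA hX; have cA := card_subgroup_neq0 hA.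
apply: (@entropy_psd_unital_le R N (twirl A) X _ _ _ _ hX).
- move=> a Y Z; rewrite /twirl scalerA mulrC -scalerA -scalerDr; congr (_ *: _).
  rewrite scaler_sumr -big_split; apply: eq_bigr => u _ /=.
  by rewrite mulmxDr mulmxDl -scalemxAr -scalemxAl.
- move=> Y hY; apply: psdZ; first by rewrite invr_ge0 ler0n.
  by apply: psd_sum => u _; apply: psd_conj.
- move=> Y; rewrite [LHS]mxtrace_weyl0 [RHS]mxtrace_weyl0 mxtrace_twirl //.
  by case: (subgroup_perp A) => ->.
- rewrite /twirl.
  under eq_bigr do rewrite mulmx1 weyl_unitary //.
  by rewrite sumr_const -[X in _ *: X]scaler_nat scalerA mulVf // scale1r.
Qed.

(** For an isotropic subgroup, the normalized projector onto the common fixed space of its Weyl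
    operators; its characteristic function is the indicator of [A]. *)
Definition stab A : 'M[C]_N := (N%:R)^-1 *: \sum_(z in A) weyl R z.

Lemma subgroup_opp (T : finZmodType) (B : {set T}) x :
  subgroup_set B -> (- x \in B) = (x \in B).
Proof.
move=> [B0 BB]; have BN y : y \in B -> - y \in B by move=> hy; rewrite -sub0r BB.
by apply/idP/idP => /BN //; rewrite opprK.
Qed.

Lemma N_neq0 : (N%:R : C) != 0.
Proof. by rewrite pnatr_eq0 -lt0n (hdimE n d_prime) expn_gt0 prime_gt0. Qed.

Lemma mxtrace_stab A z : subgroup_set A -> isotropic_set A ->
  \tr (stab A *m weyl R z) = (z \in A)%:R.
Proof.
move=> hA iA; rewrite /stab -scalemxAl mxtraceZ mulmx_suml raddf_sum /=.
have tr2 u : \tr (weyl R u *m weyl R z) = if u == - z then N%:R else 0.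
  rewrite weylM // mxtraceZ mxtrace_weyl // addr_eq0.
  case: eqP => [->|_]; last by rewrite mulr0.
  by rewrite sympNl sympvv oppr0 mulr0 chi0 mul1r.
under eq_bigr do rewrite tr2.
have [zA|zA] := boolP (z \in A).
  rewrite (bigD1 (- z)) ?subgroup_opp //= eqxx big1 ?addr0 ?mulVf ?N_neq0 //.
  by move=> u /andP[_ /negPf ->].
rewrite big1 ?mulr0 // => u uA; case: eqP => // uz.
by case/negP: zA; rewrite -(opprK z) -uz subgroup_opp.
Qed.

(** Isotropy removes the cocycle, so each Weyl operator from [A] fixes the sum [P]; hence [P] is a
    positive multiple of its own Gram matrix. *)
Lemma stab_state A : subgroup_set A -> isotropic_set A -> is_state (stab A).
Proof.
move=> hA iA; split; last by rewrite mxtrace_weyl0 mxtrace_stab //; case: hA => ->.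
apply: psdZ; first by rewrite invr_ge0 ler0n.
set P := \sum_(z in A) _; have -> : P = (#|A|%:R)^-1 *: (P ^t* *m P).
  have -> : P ^t* = \sum_(z in A) weyl R (- z : V).
    rewrite /P raddf_sum map_mx_sum; apply: eq_bigr => z _.
    exact: weyl_adj.
  have shift (z : V) : z \in A -> weyl R (- z : V) *m P = P.
    move=> zA; rewrite /P mulmx_sumr (reindex_inj (addrI z)) /=.
    apply: eq_big => [u|u uA].
      case: hA => A0 AB; apply/idP/idP => [h|h].
        by rewrite -[u](addKr z) addrC AB.
      by rewrite addrC -[z]opprK AB // -sub0r AB.
    rewrite weylM // addKr iA ?mulr0 ?chi0 ?scale1r //.
    by rewrite subgroup_opp.
  rewrite mulmx_suml; under eq_bigr => z zA do rewrite shift //.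
  by rewrite sumr_const -[X in _ *: X]scaler_nat scalerA mulVf ?scale1r // card_subgroup_neq0.
by apply: psdZ; [rewrite invr_ge0 ler0n|exact: psd_gram].
Qed.

(* With [c = \tr (U rho)], the trace of [(U - c) rho (U - c)^*] is [2 - 2 |c|^2 = 0]. *)
Lemma state_unitary_eigen m (rho U : 'M[C]_m) : is_state rho ->
  U ^t* *m U = 1%:M -> `|\tr (U *m rho)| = 1 -> U *m rho = \tr (U *m rho) *: rho.
Proof.
move=> [hr tr1] UU; set c := \tr _ => c1.
pose B := U - c%:M.
have cc : c * c^* = 1 by rewrite -normCK c1 expr1n.
have tr_rU : \tr (rho *m U ^t*) = c^*.
  rewrite -{1}(psd_adj hr) -adjmxM /c /mxtrace rmorph_sum.
  by apply: eq_bigr => i _; rewrite !mxE.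
have trB : \tr (B *m rho *m B ^t*) = 0.
  have -> : B ^t* = U ^t* - (c^*)%:M.
    by apply/matrixP => i j; rewrite !mxE eq_sym rmorphB rmorphMn.
  rewrite mulmxBr !mulmxBl !mul_mx_scalar !mul_scalar_mx -scalemxAl.
  rewrite !raddfB /= !mxtraceZ -/c tr_rU tr1 mulr1.
  rewrite -mulmxA mxtrace_mulC -mulmxA UU mulmx1 tr1.
  by rewrite [_ * c]mulrC cc !subrr addr0.
(* The vanishing trace is a sum of squared norms of the vectors [B *m w j], so [B] kills every [w j]
   and hence [rho]. *)
have [w wE] := psd_rank1_sum hr.
have Bw j : B *m w j = 0.
  have h1 : \sum_j \tr ((B *m w j) *m (B *m w j) ^t*) = 0.
    rewrite -[RHS]trB wE mulmx_sumr mulmx_suml raddf_sum; apply: eq_bigr => k _ /=.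
    by rewrite adjmxM !mulmxA.
  have trE (v : 'cV[C]_m) : \tr (v *m v ^t*) = \sum_i `|v i 0| ^+ 2.
    by apply: eq_bigr => i _; rewrite mxE big_ord1 !mxE normCK.
  have ge (v : 'cV[C]_m) : 0 <= \tr (v *m v ^t*).
    by rewrite trE sumr_ge0 // => i _; rewrite exprn_ge0.
  have /(_ j isT) := psumr_eq0P (fun k _ => ge (B *m w k)) h1.
  rewrite trE => /psumr_eq0P h2; apply/colP => i; rewrite [RHS]mxE; apply/eqP.
  rewrite -normr_eq0 -sqrf_eq0; apply/eqP/(h2 _ i isT) => k _.
  exact: exprn_ge0 (normr_ge0 _).
apply/eqP; rewrite -subr_eq0 -mul_scalar_mx -mulmxBl -/B wE mulmx_sumr big1 //.
by move=> j _; rewrite mulmxA Bw mul0mx.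
Qed.

(** * The exact stabilizer skeleton *)

Section Skeleton.
Variable rho : 'M[C]_N.
Hypothesis rho_state : is_state rho.

Definition skeleton_set : {set V} := [set z | z \in skeleton rho].

(** By [state_unitary_eigen], modulus one means that [weyl R z] acts on [rho] as a unimodular
    scalar; in this form the relations can be multiplied and inverted. *)
Lemma skeleton_setP z :
  reflect (exists2 c : C, `|c| = 1 & weyl R z *m rho = c *: rho) (z \in skeleton_set).
Proof.
(* [char_fun] uses the adjoint Weyl operator, so its value is a conjugate and has the same
   modulus. *)
have tr_adj : \tr (rho *m weyl R (- z : V)) = (\tr (weyl R z *m rho))^*.
  rewrite -weyl_adj // -{1}(psd_adj rho_state.1) -adjmxM /mxtrace rmorph_sum.
  by apply: eq_bigr => i _; rewrite !mxE.
rewrite inE /skeleton inE /char_fun [\tr _]tr_adj norm_conjC.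
apply: (iffP eqP) => [h|[c c1 ->]]; last by rewrite mxtraceZ rho_state.2 mulr1.
exists (\tr (weyl R z *m rho)) => //.
by apply: state_unitary_eigen => //; apply: weyl_unitaryV.
Qed.

Lemma subgroup_skeleton : subgroup_set skeleton_set.
Proof.
split; first by apply/skeleton_setP; exists 1; rewrite ?normr1 // weyl0 // mul1mx scale1r.
move=> u v /skeleton_setP[c c1 hu] /skeleton_setP[e e1 hv]; apply/skeleton_setP.
have e0 : e != 0 by rewrite -normr_eq0 e1 oner_eq0.
have hNv : weyl R (- v : V) *m rho = e^-1 *: rho.
  rewrite -weyl_adj // -[X in _ *m X = _](scalerK e0) -hv -scalemxAr mulmxA.
  by rewrite weyl_unitaryV // mul1mx.
pose t := chi (2%:R^-1 * symp u (- v : V)).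
have t0 : t != 0 by apply: chi_neq0.
exists (t^-1 * (c * e^-1)); first by rewrite !normrM !normfV c1 e1 norm_chi // invr1 !mulr1.
rewrite [c * _]mulrC -scalerA -scalerA -hu; apply: (canRL (scalerK t0)).
have hw := weylM R d_prime d_odd u (- v); rewrite -/t in hw.
by rewrite [LHS]scalemxAl -hw -mulmxA hNv -scalemxAr.
Qed.

(** Conjugating by [weyl R v] multiplies [weyl R u] by [chi (symp u v)]; as both act on [rho] by
    scalars, this phase is 1. *)
Lemma isotropic_skeleton : isotropic_set skeleton_set.
Proof.
move=> u v /skeleton_setP[c c1 hu] /skeleton_setP[e e1 hv].
have c0 : c != 0 by rewrite -normr_eq0 c1 oner_eq0.
have e0 : e != 0 by rewrite -normr_eq0 e1 oner_eq0.
have h := weyl_conj R d_prime d_odd v u.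
have : chi (symp u v) *: (c *: rho) = c *: rho.
  rewrite -[in LHS]hu [LHS]scalemxAl -h -!mulmxA hv -!scalemxAr hu -scalemxAr.
  rewrite scalerA mulrC -scalerA; congr (c *: _).
  by rewrite scalemxAr -hv mulmxA weyl_unitaryV // mul1mx.
move/(congr1 mxtrace); rewrite !mxtraceZ rho_state.2 mulr1 => /eqP.
by rewrite -subr_eq0 -{2}(mul1r c) -mulrBl mulf_eq0 (negPf c0) orbF subr_eq0 chi_eq1 // => /eqP.
Qed.

End Skeleton.

(** * Isotropic subspaces and their maximal extensions *)

Local Notation W := (phase_space d n).

Definition vspace_set (M : {vspace W}) : {set V} := [set z : V | (z : W) \in M].

Lemma subgroup_vspace_set M : subgroup_set (vspace_set M).
Proof.
split=> [|x y]; rewrite !finset.in_set; first exact: mem0v.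
exact: rpredB.
Qed.

Lemma card_vspace_set M : #|vspace_set M| = (d ^ \dim M)%N.
Proof.
transitivity (#|'F_d| ^ \dim M)%N; last by rewrite card_Fp.
rewrite -(finfield.card_vspace M).
by apply: eq_card => z; rewrite inE.
Qed.

(** Over a prime field, scalar multiplication is repeated addition, so a subgroup equals its own
    span. *)
Lemma vspace_of_subgroup A : subgroup_set A ->
  exists M : {vspace W}, vspace_set M = A.
Proof.
move=> hA; have [A0 AB] := hA.
have AD x y : x \in A -> y \in A -> x + y \in A.
  by move=> hx hy; rewrite -[y]opprK AB ?subgroup_opp.
have AZ (a : 'F_d) (x : V) : x \in A -> (a *: (x : W) : V) \in A.
  move=> hx; rewrite -(natr_Zp a) scaler_nat; elim: (a : nat) => // k IH.
  by rewrite mulrS AD.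
exists <<enum A : seq W>>%VS; apply/setP => z; rewrite finset.in_set.
apply/idP/idP => [h|zA]; last by apply: memv_span; rewrite mem_enum.
rewrite (coord_span (X := in_tuple (enum A : seq W)) h).
elim/big_ind: _ => // i _; apply: AZ.
by rewrite -(mem_enum A) mem_nth.
Qed.

Lemma isotropic_vspace_setP (M : {vspace W}) :
  isotropic M <-> isotropic_set (vspace_set M).
Proof.
split=> h u v; first by rewrite !finset.in_set; apply: h.
by move=> uM vM; apply: h; rewrite finset.in_set.
Qed.

Lemma maximal_isotropic_card (M : {vspace W}) :
  maximal_isotropic M -> #|vspace_set M| = N.
Proof. by case=> _ dM; rewrite card_vspace_set dM (hdimE n d_prime). Qed.

(** [M] lies in its complement, and the two cardinalities multiply to [d ^ (2 n)]. *)
Lemma isotropic_dim_leq (M : {vspace W}) : isotropic M -> (\dim M <= n)%N.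
Proof.
move=> /isotropic_vspace_setP/isotropic_subset_perp/subset_leq_card.
have := card_perp (subgroup_vspace_set M).
rewrite card_vspace_set (hdimE n d_prime) => h1 h2.
have := leq_mul (leqnn (d ^ \dim M)) h2; rewrite h1 -!expnD leq_exp2l ?prime_gt1 //.
lia.
Qed.

(** Below dimension [n], counting makes the complement strictly larger than [M]; adjoining any
    further vector [v] of it keeps isotropy. The induction is on a bound for [n - \dim M]. *)
Lemma isotropic_extension (M : {vspace W}) : isotropic M ->
  exists2 L : {vspace W}, maximal_isotropic L & (M <= L)%VS.
Proof.
move: {2}(n - \dim M)%N (leqnn (n - \dim M)) => k.
elim: k M => [|k IH] M hk iM.
  exists M; last exact: subvv.
  by split => //; apply/eqP; rewrite eqn_leq isotropic_dim_leq //= -subn_eq0 -leqn0.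
have [dM|dM] := eqVneq (\dim M) n; first by exists M; rewrite ?subvv.
have ltM : (\dim M < n)%N by rewrite ltn_neqAle dM isotropic_dim_leq.
have /isotropic_vspace_setP iA := iM.
have : ~~ (perp (vspace_set M) \subset vspace_set M).
  apply/negP => /subset_leq_card.
  have := card_perp (subgroup_vspace_set M).
  rewrite card_vspace_set (hdimE n d_prime) => h1 h2.
  have := leq_mul (leqnn (d ^ \dim M)) h2; rewrite h1 -!expnD leq_exp2l ?prime_gt1 //.
  lia.
case/subsetPn => v /perpP hv; rewrite finset.in_set => vM.
have iM' : isotropic (M + <[v : W]>)%VS.
  move=> x y /memv_addP[x1 x1M [_ /vlineP[a ->] ->]] /memv_addP[y1 y1M [_ /vlineP[b ->] ->]].
  have -> : symp (x1 + a *: (v : W)) (y1 + b *: (v : W)) =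
      symp x1 y1 - b * symp v x1 + a * symp v y1.
    by rewrite /symp /= !dotE [dot v.1 x1.2]dotC [dot x1.1 v.2]dotC; ring.
  rewrite iM // !hv ?finset.in_set //; ring.
have dM' : (\dim M < \dim (M + <[v : W]>))%N.
  have := dimv_leqif_sup (addvSl M <[v : W]>%VS) => -[le eq].
  rewrite ltn_neqAle le eq andbT; apply/negP => h.
  by case/negP: vM; rewrite memvE; apply: subv_trans (addvSr M _) h.
have [|L hL sL] := IH _ _ iM'; first by lia.
by exists L => //; apply: subv_trans sL; apply: addvSl.
Qed.

End Subgroups.

(** * The convolutional channel *)

Lemma det_mx2 (F : comNzRingType) (A : 'M[F]_2) :
  \det A = A 0 0 * A 1 1 - A 0 1 * A 1 0.
Proof.
rewrite (expand_det_row _ 0) !big_ord_recl big_ord0 addr0 /cofactor !det_mx11 !mxE.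
rewrite /= !addn0 !add0n expr0 expr1 mul1r mulN1r mulrN.
by do ?[congr (_ * _ - _ * _) | congr (A _ _); apply: val_inj].
Qed.

Section Cramer2.
Variables (F : fieldType) (a b c e : F).
Hypothesis D0 : a * e - b * c != 0.
Local Notation D := (a * e - b * c).

Lemma cramer2_mulK x y : let X := D^-1 * e * x - D^-1 * c * y in
  let Y := - (D^-1 * b) * x + D^-1 * a * y in
  a * X + c * Y = x /\ b * X + e * Y = y.
Proof. by split; field. Qed.

Lemma cramer2_Kmul x y : let X := a * x + c * y in let Y := b * x + e * y in
  D^-1 * e * X - D^-1 * c * Y = x /\ - (D^-1 * b) * X + D^-1 * a * Y = y.
Proof. by split; field. Qed.

(** Exponents in [mxtrace_conv]: [h] is one half, and [s], [t], [u] are the dot products of [z.1]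
    with [z.2], the output label and the traced label. The terms in [u] cancel. *)
Lemma conv_phase h s t u :
  h * s + t = h * (D^-1 * e * (a * s)) + D^-1 * e * (a * t + c * u) +
    (h * (- (D^-1 * c) * (b * s)) + - (D^-1 * c) * (b * t + e * u)).
Proof. by field. Qed.

End Cramer2.

Section Channel.
Variables (R : realType) (d n : nat).
Hypothesis d_prime : prime d.
Hypothesis d_odd : odd d.
Local Notation C := R[i].
Local Notation chi := (@omega_pow R d).
Local Notation N := (hdim d n).
Local Notation V := ('rV['F_d]_n * 'rV['F_d]_n)%type.
Implicit Types (x y k : 'rV['F_d]_n) (u v z : V) (X Y rho sigma : 'M[C]_N) (A : {set V}).

Definition ket2 x y : 'I_(N * N) := mxtens_index (ket x, ket y).

Lemma ket2_inj x y x' y' : (ket2 x y == ket2 x' y') = ((x, y) == (x', y')).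
Proof.
apply/eqP/eqP => [|[-> ->] //].
by move/(can_inj (@mxtens_indexK _ _)) => -[/(can_inj (@ketK d n)) -> /(can_inj (@ketK d n)) ->].
Qed.

Lemma sum_ket2 (F : 'I_(N * N) -> C) : \sum_i F i = \sum_(a : V) F (ket2 a.1 a.2).
Proof.
apply: reindex; exists (fun i => (label (mxtens_unindex i).1, label (mxtens_unindex i).2)).
  by move=> [x y] _; rewrite /ket2 mxtens_indexK !ketK.
by move=> i _; rewrite /ket2 !labelK -surjective_pairing mxtens_unindexK.
Qed.

Section Fixed.
Variable G : 'M['F_d]_2.
Hypothesis G_unit : G \in unitmx.

(** The transpose of [G] acting on pairs of labels; it inverts [conv_map G]. *)
Definition conv_inv (a : V) : V :=
  (G 0 0 *: a.1 + G 1 0 *: a.2, G 0 1 *: a.1 + G 1 1 *: a.2).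

Lemma det_neq0 : \det G != 0.
Proof. by move: G_unit; rewrite unitmxE unitfE. Qed.

Lemma conv_mapK (a : V) : conv_inv (conv_map G a.1 a.2) = a.
Proof.
case: a => x y; rewrite /conv_inv /conv_map /=.
have := det_neq0; rewrite det_mx2 => D0.
by congr (_, _); apply/rowP => i; rewrite !mxE;
  case: (cramer2_mulK D0 (x 0 i) (y 0 i)).
Qed.

Lemma conv_invK (a : V) : conv_map G (conv_inv a).1 (conv_inv a).2 = a.
Proof.
case: a => x y; rewrite /conv_inv /conv_map /=.
have := det_neq0; rewrite det_mx2 => D0.
by congr (_, _); apply/rowP => i; rewrite !mxE;
  case: (cramer2_Kmul D0 (x 0 i) (y 0 i)).
Qed.

Lemma conv_unitaryE (a b : V) :
  @conv_unitary R d n G (ket2 a.1 a.2) (ket2 b.1 b.2) = (b == conv_inv a)%:R.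
Proof.
rewrite /conv_unitary mxE /ket2 mxtens_indexK /= !ketK.
rewrite -/(ket2 _ _) -/(ket2 _ _) ket2_inj -!surjective_pairing.
rewrite -/(conv_map G b.1 b.2).
congr (_%:R); congr nat_of_bool; apply/eqP/eqP => [->|->].
  by rewrite conv_mapK.
by rewrite conv_invK.
Qed.

Lemma conv_unitary_inv x y : @conv_unitary R d n G (ket2 x y)
  (ket2 (G 0 0 *: x + G 1 0 *: y) (G 0 1 *: x + G 1 1 *: y)) = 1.
Proof. by rewrite (conv_unitaryE (x, y) (conv_inv (x, y))) eqxx. Qed.

Lemma conv_channelE sigma rho x y :
  conv_channel G sigma rho (ket x) (ket y) =
  \sum_k rho (ket (G 0 0 *: x + G 1 0 *: k)) (ket (G 0 0 *: y + G 1 0 *: k))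
       * sigma (ket (G 0 1 *: x + G 1 1 *: k)) (ket (G 0 1 *: y + G 1 1 *: k)).
Proof.
rewrite /conv_channel /ptrace2 mxE sum_ket; apply: eq_bigr => k _.
rewrite -/(ket2 x k) -/(ket2 y k) mxE sum_ket2 (bigD1 (conv_inv (y, k))) //=.
rewrite [X in _ + X]big1 => [|b hb]; last first.
  by rewrite adjmxE (conv_unitaryE (y, k)) (negPf hb) conjC0 mulr0.
rewrite adjmxE conv_unitary_inv conjC1 mulr1 addr0.
rewrite mxE sum_ket2 (bigD1 (conv_inv (x, k))) //=.
rewrite [X in _ + X]big1 => [|b hb]; last first.
  by rewrite (conv_unitaryE (x, k)) (negPf hb) mul0r.
by rewrite conv_unitary_inv mul1r addr0 /ket2 tensmxE.
Qed.

(** The diagonal maps through which the convolution acts on characteristic functions. *)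
Definition scale2 (a b : 'F_d) z : V := (a *: z.1, b *: z.2).

Lemma scale2_0 a b : scale2 a b (0 : V) = 0.
Proof. by rewrite /scale2 /= !scaler0. Qed.

Lemma scale2_eq0 a b z : a != 0 -> b != 0 -> (scale2 a b z == 0) = (z == 0).
Proof.
move=> a0 b0; case: z => p q; rewrite /scale2 /=.
apply/eqP/eqP => [[/eqP]|[-> ->]]; last by rewrite !scaler0.
by rewrite scaler_eq0 (negPf a0) => /eqP -> /eqP; rewrite scaler_eq0 (negPf b0) => /eqP ->.
Qed.


(** Convolution theorem: substituting [conv_inv] for the pair of output and traced labels decouples
    the double sum, and [conv_phase] splits the phase. *)
Lemma mxtrace_conv sigma rho z :
  \tr (conv_channel G sigma rho *m weyl R z) =
  \tr (rho *m weyl R (scale2 ((\det G)^-1 * G 1 1) (G 0 0) z)) *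
  \tr (sigma *m weyl R (scale2 (- ((\det G)^-1 * G 1 0)) (G 0 1) z)).
Proof.
rewrite [LHS]mxtrace_mul_weyl // [X in _ = X * _]mxtrace_mul_weyl //.
rewrite [X in _ = _ * X]mxtrace_mul_weyl //.
under eq_bigr do rewrite conv_channelE mulr_suml.
rewrite mulr_suml; under [RHS]eq_bigr do rewrite mulr_sumr.
rewrite !pair_big /= [RHS](reindex conv_inv) /=; last first.
  by exists (fun a => conv_map G a.1 a.2) => a _; rewrite (conv_invK, conv_mapK).
apply: eq_bigr => -[x k] _ /=.
rewrite mulrACA -(chiD R d_prime) !scalerDr -![_ + _ *: k + _]addrAC.
congr (_ * chi _); rewrite !dotE.
have := det_neq0; rewrite det_mx2 => D0.
exact: conv_phase.
Qed.

(** For rank-one inputs and a fixed traced label [k], the contribution is again rank one, with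
    vector [c k j l]. *)
Lemma conv_psd sigma rho : psd sigma -> psd rho -> psd (conv_channel G sigma rho).
Proof.
move=> /psd_rank1_sum[b sE] /psd_rank1_sum[a rE].
pose c k j l : 'cV[C]_N := \col_i (a j (ket (G 0 0 *: label i + G 1 0 *: k)) 0 *
   b l (ket (G 0 1 *: label i + G 1 1 *: k)) 0).
have -> : conv_channel G sigma rho = \sum_k \sum_j \sum_l c k j l *m (c k j l) ^t*.
  apply: ket_matrixP => x y; rewrite conv_channelE summxE; apply: eq_bigr => k _.
  rewrite rE sE !summxE mulr_suml; apply: eq_bigr => j _.
  rewrite mulr_sumr summxE; apply: eq_bigr => l _.
  by rewrite !mxE !big_ord1 !mxE !ketK rmorphM mulrACA.
by do 3 (apply: psd_sum => ? _); apply: psd_rank1.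
Qed.

Lemma mxtrace_conv_channel sigma rho :
  \tr (conv_channel G sigma rho) = \tr rho * \tr sigma.
Proof.
rewrite mxtrace_weyl0 // mxtrace_conv.
by rewrite !scale2_0 -!mxtrace_weyl0.
Qed.

Lemma conv_state sigma rho : is_state sigma -> is_state rho ->
  is_state (conv_channel G sigma rho).
Proof.
move=> [hs ts] [hr tr]; split; first exact: conv_psd hs hr.
by rewrite mxtrace_conv_channel ts tr mulr1.
Qed.

Lemma entropy_conv_ge sigma rho : positive_convolution G ->
  psd sigma -> is_state rho -> entropy sigma <= entropy (conv_channel G sigma rho).
Proof.
move=> [_ G0] hs [hr tr].
apply: (@entropy_psd_unital_le R N (fun X => conv_channel G X rho) sigma _ _ _ _ hs).
- move=> a X Y; apply: (weyl_char_inj d_prime d_odd) => z.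
  rewrite [LHS]mxtrace_conv [RHS]mxtrace_mul_weyl_linear.
  rewrite [X in _ = a * X + _]mxtrace_conv [X in _ = _ + X]mxtrace_conv.
  by rewrite [X in _ * X = _]mxtrace_mul_weyl_linear mulrDr mulrCA.
- move=> X hX; exact: conv_psd hX hr.
- by move=> X; rewrite mxtrace_conv_channel tr mul1r.
(* Unitality: as [G 1 0] and [G 0 1] are nonzero, the second scaling is injective, so the identity
   still contributes only at [z = 0]. *)
- apply: (weyl_char_inj d_prime d_odd) => z.
  rewrite mxtrace_conv !mul1mx !mxtrace_weyl // scale2_eq0 //; last first.
    by rewrite oppr_eq0 mulf_neq0 ?invr_eq0 ?det_neq0.
  case: eqP => [->|_]; last by rewrite mulr0.
  by rewrite !scale2_0 -mxtrace_weyl0 // tr mul1r.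
Qed.

End Fixed.
End Channel.

(** * Bounds on the Holevo information *)

Section Bounds.
Variables (R : realType) (d n : nat).
Hypothesis d_prime : prime d.
Hypothesis d_odd : odd d.
Local Notation C := R[i].
Local Notation chi := (@omega_pow R d).
Local Notation N := (hdim d n).
Local Notation V := ('rV['F_d]_n * 'rV['F_d]_n)%type.
Local Notation W := (phase_space d n).
Implicit Types (u v z : V) (X rho sigma : 'M[C]_N) (A : {set V}).

(** A preimage, so that membership unfolds directly to membership in [A]. *)
Definition scale2_preim (a b : 'F_d) A : {set V} := [set z | scale2 a b z \in A].

Lemma scale2_comp a b a' b' z :
  scale2 a b (scale2 a' b' z) = scale2 (a * a') (b * b') z.
Proof. by rewrite /scale2 /= !scalerA. Qed.

Lemma scale2_1 z : scale2 1 1 z = z.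
Proof. by case: z => p q; rewrite /scale2 /= !scale1r. Qed.

Lemma subgroup_scale2_preim a b A : subgroup_set A -> subgroup_set (scale2_preim a b A).
Proof.
case=> A0 AB; split=> [|x y]; rewrite !finset.in_set; first by rewrite scale2_0.
move=> hx hy; have -> : scale2 a b (x - y) = scale2 a b x - scale2 a b y.
  by rewrite /scale2 /= !scalerBr.
exact: AB.
Qed.

Lemma symp_scale2 a b u v : symp (scale2 a b u) (scale2 a b v) = a * b * symp u v.
Proof. by rewrite /symp /= !dotE; ring. Qed.

Lemma isotropic_scale2_preim a b A : a != 0 -> b != 0 ->
  isotropic_set A -> isotropic_set (scale2_preim a b A).
Proof.
move=> a0 b0 iA u v; rewrite !finset.in_set => hu hv.
have /eqP := iA _ _ hu hv.
by rewrite symp_scale2 !mulf_eq0 (negPf a0) (negPf b0) => /eqP.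
Qed.

Lemma mxtrace_char_stab sigma G A a b z : G \in unitmx ->
  subgroup_set A -> isotropic_set A -> a != 0 -> b != 0 ->
  \tr (conv_channel G sigma (stab R (scale2_preim a b A)) *m weyl R z) =
  (scale2 a b (scale2 ((\det G)^-1 * G 1 1) (G 0 0) z) \in A)%:R *
  \tr (sigma *m weyl R (scale2 (- ((\det G)^-1 * G 1 0)) (G 0 1) z)).
Proof.
move=> Gu hA iA a0 b0; rewrite [LHS]mxtrace_conv //; congr (_ * _).
rewrite [LHS]mxtrace_stab ?finset.in_set //.
  exact: subgroup_scale2_preim.
exact: isotropic_scale2_preim.
Qed.

(* Its determinant is 1 and its channel rescales the second characteristic function
   by [(b1^-1, b2^-1)]. *)
Definition reverse_conv (b1 b2 : 'F_d) : 'M['F_d]_2 :=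
  \matrix_(i, j) if i == 0 then (if j == 0 then 1 else b2^-1)
                 else (if j == 0 then - b1^-1 else 1 - (b1 * b2)^-1).

Lemma reverse_convE b1 b2 : let G := reverse_conv b1 b2 in
  [/\ G 0 0 = 1, G 0 1 = b2^-1, G 1 0 = - b1^-1 & G 1 1 = 1 - (b1 * b2)^-1].
Proof. by split; rewrite mxE. Qed.

Lemma det_reverse_conv b1 b2 : \det (reverse_conv b1 b2) = 1.
Proof.
rewrite det_mx2; case: (reverse_convE b1 b2) => -> -> -> ->.
by rewrite mul1r mulrN opprK invfM mulrC subrK.
Qed.

(** The condition on [b1 * b2] says that the lower right entry is nonzero. *)
Lemma positive_reverse_conv b1 b2 : b1 != 0 -> b2 != 0 -> b1 * b2 != 1 ->
  positive_convolution (reverse_conv b1 b2).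
Proof.
move=> b10 b20 b1b2; split; first by rewrite unitmxE det_reverse_conv unitr1.
have [e00 e01 e10 e11] := reverse_convE b1 b2.
move=> i j; rewrite mxE; case: ifP => _; case: ifP => _.
- exact: oner_neq0.
- by rewrite invr_eq0.
- by rewrite oppr_eq0 invr_eq0.
- by rewrite subr_eq0 eq_sym invr_eq1.
Qed.

Section Channel.
Variable G : 'M['F_d]_2.
Hypothesis G_pos : positive_convolution G.
Variable sigma : 'M[C]_N.
Hypothesis sigma_state : is_state sigma.

(** The scalings of [mxtrace_conv]: [(a1, a2)] on the input and [(b1, b2)] on [sigma]. *)
Let a1 := (\det G)^-1 * G 1 1.
Let a2 := G 0 0.
Let b1 := - ((\det G)^-1 * G 1 0).
Let b2 := G 0 1.

Let a1_neq0 : a1 != 0.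
Proof. by rewrite mulf_neq0 ?invr_eq0 ?(det_neq0 G_pos.1) ?G_pos.2. Qed.
Let a2_neq0 : a2 != 0. Proof. exact: G_pos.2. Qed.
Let b1_neq0 : b1 != 0.
Proof. by rewrite oppr_eq0 mulf_neq0 ?invr_eq0 ?(det_neq0 G_pos.1) ?G_pos.2. Qed.
Let b2_neq0 : b2 != 0. Proof. exact: G_pos.2. Qed.

(** The determinant formula; since [a1 * a2] is nonzero, it yields [b1 * b2 != 1]. *)
Let a_b : a1 * a2 + b1 * b2 = 1.
Proof.
have D0 := det_neq0 G_pos.1.
rewrite /a1 /a2 /b1 /b2 mulNr -!mulrA -mulrBr [G 1 1 * _]mulrC [G 1 0 * _]mulrC.
by rewrite -det_mx2 mulVf.
Qed.

Let b_neq1 : b1 * b2 != 1.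
Proof. by rewrite -a_b -subr_eq0 opprD addrCA subrr addr0 oppr_eq0 mulf_neq0. Qed.

(** * The probe state, its Weyl orbit and the reverse convolution *)

Section Pinching.
Variable A : {set V}.
Hypothesis A_subgroup : subgroup_set A.
Hypothesis A_isotropic : isotropic_set A.
Hypothesis A_card : #|A| = N.

(** The ratios turn the input scaling [(a1, a2)] into [(b1, b2)], so the indicator and [sigma] are
    evaluated at the same point. *)
Definition probe : 'M[C]_N := stab R (scale2_preim (b1 / a1) (b2 / a2) A).

Lemma probe_state : is_state probe.
Proof.
apply: stab_state => //; first exact: subgroup_scale2_preim.
by apply: isotropic_scale2_preim => //; rewrite mulf_neq0 ?invr_eq0.
Qed.

Lemma mxtrace_conv_probe z : \tr (conv_channel G sigma probe *m weyl R z) =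
  (scale2 b1 b2 z \in A)%:R * \tr (sigma *m weyl R (scale2 b1 b2 z)).
Proof.
rewrite [LHS]mxtrace_char_stab ?mulf_neq0 ?invr_eq0 ?G_pos.1 //.
by rewrite scale2_comp !divfK.
Qed.

(* Convolving the output with the reverse matrix undoes the scaling of the
   characteristic function of [sigma], up to the restriction to [A]. *)
Lemma entropy_conv_probe :
  entropy (conv_channel G sigma probe) <= entropy (twirl A sigma).
Proof.
set tau := conv_channel G sigma probe.
pose G' := reverse_conv b1 b2.
have G'_pos : positive_convolution G' by exact: positive_reverse_conv.
pose c := G' 1 1.
have c0 : c != 0 by exact: G'_pos.2.
have [e00 e01 e10 e11] := reverse_convE b1 b2.
(* Cancels the input scaling [(c, 1)] of [G'], leaving the indicator of [A] at [z] itself. *)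
pose rho' := stab R (scale2_preim c^-1 1 A).
have rho'_state : is_state rho'.
  apply: stab_state => //; first exact: subgroup_scale2_preim.
  by apply: isotropic_scale2_preim; rewrite ?invr_eq0 ?oner_neq0.
have [tau_psd _] := conv_state d_prime d_odd G_pos.1 sigma_state probe_state.
have -> : twirl A sigma = conv_channel G' tau rho'; last first.
  exact: (entropy_conv_ge d_prime d_odd G'_pos.1 G'_pos tau_psd rho'_state).
apply: (weyl_char_inj d_prime d_odd) => z; symmetry.
rewrite [RHS]mxtrace_twirl // perp_lagrangian //.
rewrite [LHS]mxtrace_char_stab ?invr_eq0 ?oner_neq0 ?G'_pos.1 //.
rewrite /G' e00 e01 e10 det_reverse_conv invr1 !mul1r opprK scale2_comp.
rewrite mulVf // mul1r scale2_1.
case: ifP => zA; last by rewrite mul0r.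
rewrite mul1r [LHS]mxtrace_conv_probe scale2_comp !divff // scale2_1 zA.
by rewrite mul1r.
Qed.

Definition ensemble_state u : 'M[C]_N := weyl R u *m probe *m (weyl R u) ^t*.

Lemma ensemble_state_state u : is_state (ensemble_state u).
Proof.
have [hp tp] := probe_state; split; first exact: psd_conj.
by rewrite /ensemble_state -mulmxA mxtrace_mulC -mulmxA weyl_unitaryV // mulmx1.
Qed.

(** Undoing the conjugation is itself a positive, unital, trace-preserving map, and it recovers
    [X]. *)
Lemma entropy_conj_weyl X v : psd X ->
  entropy (weyl R v *m X *m (weyl R v) ^t*) <= entropy X.
Proof.
move=> hX; set Y := _ *m _ *m _.
have -> : X = (weyl R v) ^t* *m Y *m weyl R v.
  by rewrite /Y !mulmxA weyl_unitaryV // mul1mx -mulmxA weyl_unitaryV // mulmx1.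
have hY : psd Y by exact: psd_conj.
apply: (@entropy_psd_unital_le R N (fun Z => (weyl R v) ^t* *m Z *m weyl R v) Y _ _ _ _ hY).
- by move=> a Z1 Z2 /=; move: (weyl R v) => U; rewrite mulmxDr mulmxDl -scalemxAr -scalemxAl.
- by move=> Z hZ; have := psd_conj ((weyl R v) ^t*) hZ; rewrite trmxCK.
- by move=> Z /=; rewrite -mulmxA mxtrace_mulC -mulmxA weyl_unitary // mulmx1.
- by rewrite /= mulmx1 weyl_unitaryV.
Qed.

(** Weyl covariance of the channel. The scalars swap places because moving a scaling across the
    symplectic form exchanges its two components. *)
Lemma conv_ensemble_state u : conv_channel G sigma (ensemble_state u) =
  weyl R (scale2 a2 a1 u) *m conv_channel G sigma probe *m (weyl R (scale2 a2 a1 u)) ^t*.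
Proof.
apply: (weyl_char_inj d_prime d_odd) => z.
rewrite [LHS](mxtrace_conv d_prime d_odd G_pos.1).
rewrite [RHS](mxtrace_weyl_conj d_prime d_odd) [X in _ = _ * X](mxtrace_conv d_prime d_odd G_pos.1).
rewrite [X in X * _ = _](mxtrace_weyl_conj d_prime d_odd) mulrA; congr (chi _ * _ * _).
by rewrite /symp /= !dotE -/a1 -/a2; ring.
Qed.

(** The full twirl leaves only [z = 0], since the complement of the whole phase space is trivial. *)
Lemma conv_average :
  conv_channel G sigma (twirl [set: V] probe) = (N%:R^-1)%:M.
Proof.
apply: (weyl_char_inj d_prime d_odd) => z.
rewrite [LHS](mxtrace_conv d_prime d_odd G_pos.1).
rewrite [X in X * _ = _]mxtrace_twirl //; last exact: subgroup_setT.
rewrite perpT finset.in_set1 scale2_eq0 //.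
rewrite mul_scalar_mx mxtraceZ mxtrace_weyl //.
case: eqP => [->|_]; last by rewrite mul0r mulr0.
rewrite !scale2_0 -!mxtrace_weyl0 // probe_state.2 sigma_state.2 mul1r mulVf //.
exact: N_neq0.
Qed.

End Pinching.

Lemma log2_hdim : log2 (N%:R : R) = n%:R * log2 d%:R.
Proof.
rewrite /log2 hdimE // natrX lnXn ?ltr0n ?prime_gt0 //.
by rewrite -[ln _ *+ n]mulr_natl mulrA.
Qed.

Lemma ensemble_average k (p : 'I_k -> R) (rho : 'I_k -> 'M[C]_N) :
  is_ensemble p rho -> is_state (\sum_i (p i)%:C *: rho i).
Proof.
case=> p0 p1 hr; split.
  by apply: psd_sum => i _; apply: psdZ; [rewrite ler0c|exact: (hr i).1].
rewrite raddf_sum /= (eq_bigr (fun i => (p i)%:C)) => [|i _].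
  by rewrite -rmorph_sum p1.
by rewrite mxtraceZ (hr i).2 mulr1.
Qed.

Lemma holevo_quantity_le k (p : 'I_k -> R) (rho : 'I_k -> 'M[C]_N) :
  is_ensemble p rho ->
  holevo_quantity (conv_channel G sigma) p rho <= n%:R * log2 d%:R - entropy sigma.
Proof.
move=> hE; have [p0 p1 hr] := hE; rewrite /holevo_quantity; apply: lerB.
  rewrite -log2_hdim; apply/entropy_le_log/(conv_state d_prime d_odd G_pos.1 sigma_state).
  exact: ensemble_average.
rewrite -[leLHS]mul1r -p1 mulr_suml; apply: ler_sum => i _; apply: ler_wpM2l; first exact: p0.
exact: (entropy_conv_ge d_prime d_odd G_pos.1 G_pos sigma_state.1 (hr i)).
Qed.

(** Nonemptiness excludes the default value of [sup] on the empty set; [holevo_lower] supplies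
    it. *)
Lemma holevo_upper : (holevo_values (conv_channel G sigma) !=set0)%classic ->
  holevo (conv_channel G sigma) <= n%:R * log2 d%:R - entropy sigma.
Proof.
move=> h; apply: ge_sup => // _ [k [p [rho [hE ->]]]].
exact: holevo_quantity_le.
Qed.

(** The supremum dominates its members because [holevo_quantity_le] bounds the set above. *)
Lemma holevo_ge k (p : 'I_k -> R) (rho : 'I_k -> 'M[C]_N) :
  is_ensemble p rho ->
  holevo_quantity (conv_channel G sigma) p rho <= holevo (conv_channel G sigma).
Proof.
move=> hE; apply: ub_le_sup; last by exists k, p, rho.
exists (n%:R * log2 d%:R - entropy sigma) => _ [k' [p' [rho' [hE' ->]]]].
exact: holevo_quantity_le.
Qed.

(** Uniform ensemble over the Weyl orbit of the probe: the average output is maximally mixed, and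
    each output has entropy at most that of the pinching. *)
Lemma holevo_lower A : subgroup_set A -> isotropic_set A -> #|A| = N ->
  (holevo_values (conv_channel G sigma) !=set0)%classic /\
  n%:R * log2 d%:R - entropy (twirl A sigma) <= holevo (conv_channel G sigma).
Proof.
move=> hA iA cA.
pose k := #|{: V}|; pose p (_ : 'I_k) : R := k%:R^-1.
pose rho (i : 'I_k) := ensemble_state A (enum_val i).
have k0 : (k%:R : R) != 0.
  by rewrite pnatr_eq0 -lt0n; apply/card_gt0P; exists 0.
have hE : is_ensemble p rho.
  split=> [i||i]; first by rewrite invr_ge0 ler0n.
    by rewrite sumr_const card_ord -[LHS]mulr_natr mulVf.
  exact: ensemble_state_state.
split; first by exists (holevo_quantity (conv_channel G sigma) p rho), k, p, rho.
apply: le_trans (holevo_ge hE); rewrite /holevo_quantity; apply: lerB.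
  have -> : \sum_i (p i)%:C *: rho i = twirl [set: V] (probe A).
    transitivity ((k%:R^-1 : R)%:C *: \sum_i rho i); first by rewrite scaler_sumr.
    rewrite /twirl cardsT fmorphV rmorph_nat; congr (_ *: _).
    rewrite [RHS](reindex (@enum_val _ {: V})) /=; last first.
      by apply: onW_bij; exact: enum_val_bij.
    by apply: eq_bigl => i; rewrite finset.in_setT.
  rewrite conv_average // entropy_maximally_mixed ?log2_hdim //.
  by rewrite hdimE // expn_gt0 prime_gt0.
rewrite -[leRHS]mul1r -(_ : \sum_i p i = 1); last by case: hE.
rewrite mulr_suml; apply: ler_sum => i _; apply: ler_wpM2l; first by rewrite invr_ge0 ler0n.
rewrite conv_ensemble_state.
apply: le_trans (entropy_conv_probe hA iA cA).
apply: entropy_conj_weyl.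
by apply: (conv_state d_prime d_odd G_pos.1 sigma_state (probe_state hA iA)).1.
Qed.

End Channel.
End Bounds.

(** * Attained minima and the mean state *)

Section Minima.
Variables (R : realType) (d n : nat).
Hypothesis d_prime : prime d.
Hypothesis d_odd : odd d.
Local Notation C := R[i].
Local Notation N := (hdim d n).
Local Notation V := ('rV['F_d]_n * 'rV['F_d]_n)%type.
Local Notation W := (phase_space d n).
Implicit Types (M : {vspace W}) (rho : 'M[C]_N).

Lemma pinchingE M rho : pinching M rho = twirl (vspace_set M) rho.
Proof.
rewrite /pinching /twirl (card_vspace_set d_prime) natrX; congr (_ *: _).
by apply: eq_bigl => u; rewrite finset.in_set.
Qed.

Lemma mxtrace_of_char_fun (xi : W -> C) (z : V) :
  \tr (of_char_fun xi *m weyl R z) = xi (- z : V).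
Proof.
rewrite /of_char_fun -scalemxAl mxtraceZ mulmx_suml raddf_sum (bigD1 (- z)) //=.
rewrite big1 ?addr0 => [|u uz].
  rewrite -scalemxAl mxtraceZ weylM // addNr sympNl sympvv oppr0 mulr0 chi0 scale1r.
  rewrite mxtrace_weyl // eqxx hdimE // natrX mulrC mulfK //.
  by rewrite expf_neq0 // pnatr_eq0 -lt0n prime_gt0.
rewrite -scalemxAl mxtraceZ weylM // mxtraceZ mxtrace_weyl // addr_eq0 (negPf uz).
by rewrite !mulr0.
Qed.

(** The inner twirl restricts the characteristic function to [M], and the outer one to the double
    complement of the skeleton, which is the skeleton itself. *)
Lemma mean_state_twirl M rho : is_state rho -> maximal_isotropic M ->
  {subset skeleton rho <= M} ->
  mean_state rho = twirl (perp (skeleton_set rho)) (twirl (vspace_set M) rho).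
Proof.
move=> hrho hM sM.
have hS := subgroup_skeleton d_prime d_odd hrho.
have hA := subgroup_vspace_set M.
have iA : isotropic_set (vspace_set M) by apply/isotropic_vspace_setP; case: hM.
have cA := maximal_isotropic_card d_prime hM.
apply: (weyl_char_inj d_prime d_odd) => z.
rewrite [LHS]mxtrace_of_char_fun.
rewrite [RHS](mxtrace_twirl d_prime d_odd _ _ (subgroup_perp _)) (perpK R d_prime hS).
rewrite [X in _ = if _ then X else _](mxtrace_twirl d_prime d_odd _ _ hA).
rewrite (perp_lagrangian R d_prime hA iA cA).
(* The left side is evaluated at [- z]; subgroups are symmetric, so membership can be tested
   there. *)
rewrite -(subgroup_opp z hS) [X in _ = if X then _ else _]finset.in_set.
case: ifP => zS; last exact: erefl.
rewrite -(subgroup_opp z hA) finset.in_set (sM _ zS).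
by rewrite /char_fun opprK.
Qed.

(** A pinching depends only on the point set of its subspace, and phase space has finitely many
    subsets. *)
Lemma is_min_entropy_pinching (P : {vspace W} -> Prop) rho : (exists M, P M) ->
  exists m : R, is_min [set entropy (pinching M rho) | M in P]%classic m.
Proof.
case=> M0 PM0.
pose Q (A : {set V}) := `[< exists2 M, P M & vspace_set M = A >].
have QM M : P M -> Q (vspace_set M) by move=> PM; apply/asboolP; exists M.
have [A QA hmin] := arg_minP (fun A : {set V} => entropy (twirl A rho)) (QM _ PM0).
exists (entropy (twirl A rho)); split.
  have /asboolP[M PM AE] := QA.
  by exists M; [exact: PM|rewrite pinchingE AE].
move=> _ [M PM <-]; rewrite pinchingE; exact: hmin (QM _ PM).
Qed.

(** Makes the families behind both minima nonempty: the skeleton is an isotropic subspace and can be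
    extended. *)
Lemma exists_maximal_isotropic_skeleton rho : is_state rho ->
  exists2 M, maximal_isotropic M & {subset skeleton rho <= M}.
Proof.
move=> hrho; have hS := subgroup_skeleton d_prime d_odd hrho.
have [S SE] := vspace_of_subgroup hS.
have [|M hM sM] := @isotropic_extension R d n d_prime d_odd S.
  by apply/isotropic_vspace_setP; rewrite SE; apply: isotropic_skeleton.
exists M => // z zS; apply: (subvP sM).
have : z \in vspace_set S by rewrite SE finset.in_set.
by rewrite finset.in_set.
Qed.

End Minima.

Local Open Scope classical_set_scope.

Theorem theorem11 (R : realType) (d n : nat) (G : 'M['F_d]_2)
    (sigma : 'M[R[i]]_(hdim d n)) :
  prime d -> odd d -> (0 < n)%N ->
  positive_convolution G -> is_state sigma ->
  exists m s : R,
    [/\ is_min [set entropy (pinching M sigma) | M in @maximal_isotropic d n] m,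
        is_min [set entropy (pinching M sigma) | M in
                  [set M | maximal_isotropic M /\ {subset skeleton sigma <= M}]]
          s,
        n%:R * log2 d%:R - m <= holevo (conv_channel G sigma)
          <= n%:R * log2 d%:R - entropy sigma,
        n%:R * log2 d%:R - s <= holevo (conv_channel G sigma) &
        n%:R * log2 d%:R - entropy (mean_state sigma) <= n%:R * log2 d%:R - s].
Proof.
move=> d_prime d_odd _ G_pos sigma_state.
have [M0 hM0 sM0] := exists_maximal_isotropic_skeleton d_prime d_odd sigma_state.
have lower M : maximal_isotropic M -> holevo_values (conv_channel G sigma) !=set0 /\
    n%:R * log2 d%:R - entropy (pinching M sigma) <= holevo (conv_channel G sigma).
  move=> hM; rewrite (pinchingE d_prime).
  apply: (holevo_lower d_prime d_odd G_pos sigma_state).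
  - exact: subgroup_vspace_set.
  - by apply/isotropic_vspace_setP; case: hM.
  - exact: maximal_isotropic_card.
have [m hm] := is_min_entropy_pinching d_prime sigma (ex_intro _ M0 hM0).
have [s hs] := is_min_entropy_pinching d_prime sigma
  (ex_intro (fun M => maximal_isotropic M /\ {subset skeleton sigma <= M}) M0
    (conj hM0 sM0)).
exists m, s; split; [exact: hm|exact: hs| | |].
- case: hm => -[M hM <-] _; rewrite (lower M hM).2 /=.
  exact: (holevo_upper d_prime d_odd G_pos sigma_state (lower M hM).1).
- by case: hs => -[M [hM _] <-] _; exact: (lower M hM).2.
- apply: lerB; first exact: lexx.
  (* At a minimizer [M], the mean state is a further twirl of the pinching, so its entropy is at
     least [s]. *)
  case: hs => -[M [hM sM] <-] _.
  rewrite (pinchingE d_prime) (mean_state_twirl d_prime d_odd sigma_state hM sM).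
  apply: (entropy_twirl d_prime d_odd); first exact: subgroup_perp.
  rewrite /twirl; apply: psdZ; first by rewrite invr_ge0 ler0n.
  by apply: psd_sum => u _; apply/psd_conj/sigma_state.1.
Qed.
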